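(* Let $f(z)=\sum_{k=0}^{\infty}a_kz^k$ and $g(z)=\sum_{k=0}^{\infty}b_kz^k$ be analytic in $\mathbb{D}$ with $|f(z)|\le|g(z)|$ for all $z\in\mathbb{D}$, and suppose $b_k\ne0$ for some non-negative integer $k$. Let $q\ge0$ be the order of the zero of $g$ at $0$ (with $q=0$ if $g(0)\ne0$). Then $$\sum_{k=0}^{\infty}|a_k|r^k\le\sum_{k=0}^{\infty}|b_k|r^k\qquad\text{for } 0\le r\le r_1(|a_q/b_q|).$$ Moreover, $r_1(|a_q/b_q|)$ cannot be improved if $|a_q/b_q|\in[1/2,1)\cup\{0\}$; that is, for every non-negative integer $q$, every $x\in[1/2,1)\cup\{0\}$ and every $r\in(r_1(x),1)$ there are such $f,g$, with $g$ having a zero of order $q$ at $0$ and $|a_q/b_q|=x$, for which the inequality fails at $r$.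
   Context: $\mathbb{D}=\{z\in\mathbb{C}:|z|<1\}$. The function $r_1:[0,1]\to\mathbb{R}$ is defined by $$r_1(x)=\begin{cases}\sqrt{\dfrac{1-x}{2}}, & x\in[0,\tfrac12),\\[2mm] \dfrac{1}{1+2x}, & x\in[\tfrac12,1].\end{cases}$$ *)

(* Defs.v *)
From Stdlib Require Import Reals.
From Coquelicot Require Import Coquelicot.

Open Scope R_scope.

(* Only the values on [0,1] are meaningful. *)
Definition r1 (x : R) : R :=
  if Rlt_dec x (1 / 2) then sqrt ((1 - x) / 2) else 1 / (1 + 2 * x).

(* [f] is the sum of the power series with complex coefficients [a] on the open
   unit disk; the values of [f] elsewhere are irrelevant. *)
Definition analytic_in_disk (f : C -> C) (a : nat -> C) : Prop :=
  forall z : C, Cmod z < 1 ->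
    @is_pseries C_AbsRing C_NormedModule a z (f z).

(* Zero order at 0 of the function whose Taylor coefficients at 0 are [b];
   [q = 0] when that function does not vanish at 0. *)
Definition zero_order_at_0 (b : nat -> C) (q : nat) : Prop :=
  b q <> RtoC 0 /\ forall k : nat, (k < q)%nat -> b k = RtoC 0.

(* [Series] is a total function; for the coefficients of a function analytic in
   the disk and 0 <= r < 1 the series below converges. *)
Definition majorant_series (a : nat -> C) (r : R) : R :=
  Series (fun k : nat => Cmod (a k) * r ^ k).

(* Main.v *)
Require Import Defs.
From Stdlib Require Import Reals Lra Lia Classical.
From Coquelicot Require Import Coquelicot.

Open Scope R_scope.

(* After division by [z^q] let [c] be the coefficients of the formal quotient
   [phi = f / g], and [x = |c_0|].  If [g] has no zero in [|z| <= kap], then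
   [phi] is holomorphic there with [|phi| <= 1], and comparing the mean squares of
   [phi (1 - t z^N)] and [1 - t z^N] on [|z| = kap] gives an inequality between
   finitely many [c_k].  Zeros of [g] are first divided out, together with those of
   [f], by Blaschke factors, which does not change [c]; only finitely many steps are
   possible since each one increases [|g 0|] at constant Hardy norm.  Letting
   [kap -> 1] and optimizing [t] yields
     [sum_(1 <= k < N) |c_k|^2 + |c_N|^2 / (1 - x^2) <= 1 - x^2],
   whence by Abel summation
     [sum_(k >= 1) |c_k|^2 p^k <= p (1 - x^2)^2 / (1 - x^2 p)] for [0 <= p <= 1].
   With Cauchy-Schwarz (for [x >= 1/2] and [p = r / x], for [x < 1/2] and [p = 1]) this
   gives [sum_k |c_k| r^k <= 1] for [r <= r1 x], and the majorant series of [f = phi g]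
   is at most the product of those of [phi] and [g].  Sharpness is witnessed by
   [g = z^q] and [phi = (x - z) / (1 - x z)], or [phi = z (s - z) / (1 - s z)] with
   [s = 1 / sqrt 2] when [x = 0]. *)

(** * Power series with geometrically decaying coefficients *)

(** A ratio [th < 1] means holomorphy beyond the closed unit disk. The dilations [f (rho z)] with
    [rho < 1] have such coefficients, so all function theory below takes place on the closed
    disk. *)
Definition geom_bounded (K th : R) (a : nat -> C) : Prop :=
  0 <= th < 1 /\ forall n : nat, Cmod (a n) <= K * th ^ n.

(** [iota] selects the unique sum, so the value is meaningful only where the series converges, as on
    the closed unit disk for [geom_bounded] coefficients. *)
Definition psum (a : nat -> C) (z : C) : C :=
  @iota C_CompleteNormedModule
    (@is_series C_AbsRing C_NormedModule (fun k => Cmult (a k) (Cpow z k))).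

Lemma pow_le_1 (x : R) (n : nat) : 0 <= x <= 1 -> 0 <= x ^ n <= 1.
Proof.
  intros Hx; split; [apply pow_le; lra|].
  rewrite <- (pow1 n); apply pow_incr; lra.
Qed.

Lemma is_series_geom_l (K th : R) :
  0 <= th < 1 -> is_series (fun n => K * th ^ n) (K / (1 - th)).
Proof.
  intros Hth.
  apply (is_series_scal_l (K := R_AbsRing) (V := R_NormedModule) K (fun n => th ^ n)).
  apply is_series_geom; rewrite Rabs_pos_eq; lra.
Qed.

Lemma is_series_C_unique (u : nat -> C) (l l' : C) :
  @is_series C_AbsRing C_NormedModule u l ->
  @is_series C_AbsRing C_NormedModule u l' -> l = l'.
Proof. exact (filterlim_locally_unique _ l l'). Qed.

Lemma is_series_psum (a : nat -> C) (K th : R) (z : C) :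
  geom_bounded K th a -> Cmod z <= 1 ->
  @is_series C_AbsRing C_NormedModule (fun k => Cmult (a k) (Cpow z k)) (psum a z).
Proof.
  intros [Hth Ha] Hz.
  destruct (@ex_series_le C_AbsRing C_CompleteNormedModule
    (fun k => Cmult (a k) (Cpow z k)) (fun n => K * th ^ n)) as [l Hl].
  { intro n; change (Cmod (a n * z ^ n)%C <= K * th ^ n).
    rewrite Cmod_mult, Cmod_pow.
    pose proof (pow_le_1 (Cmod z) n (conj (Cmod_ge_0 z) Hz)).
    specialize (Ha n); pose proof (Cmod_ge_0 (a n)); nra. }
  { exists (K / (1 - th)); now apply is_series_geom_l. }
  apply (iota_correct (V := C_CompleteNormedModule) (@is_series C_AbsRing C_NormedModule (fun k => Cmult (a k) (Cpow z k)))).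
  exists l; split; [exact Hl|].
  intros l' Hl'; exact (is_series_C_unique _ _ _ Hl Hl').
Qed.

Lemma psum_unique (a : nat -> C) (K th : R) (z l : C) :
  geom_bounded K th a -> Cmod z <= 1 ->
  @is_series C_AbsRing C_NormedModule (fun k => Cmult (a k) (Cpow z k)) l ->
  psum a z = l.
Proof.
  intros Ha Hz Hl.
  exact (is_series_C_unique _ _ _ (is_series_psum _ _ _ _ Ha Hz) Hl).
Qed.

Lemma is_series_C_Cmod_le (u : nat -> C) (b : nat -> R) (l : C) (m : R) :
  @is_series C_AbsRing C_NormedModule u l -> is_series b m ->
  (forall n, Cmod (u n) <= b n) -> Cmod l <= m.
Proof.
  intros Hu Hb Hle.
  apply (filterlim_le (F := eventually) (fun n => Cmod (sum_n u n)) (sum_n b)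
    (Finite (Cmod l)) (Finite m)).
  - exists 0%nat; intros n _.
    induction n as [|n IH].
    + rewrite !sum_O; apply Hle.
    + rewrite !sum_Sn.
      apply Rle_trans with (1 := Cmod_triangle _ _).
      apply Rplus_le_compat; auto.
  - apply (filterlim_comp _ _ _ (sum_n u) Cmod _ _ _ Hu).
    exact (filterlim_norm (K := C_AbsRing) (V := C_NormedModule) l).
  - exact Hb.
Qed.

Lemma psum_bound (a : nat -> C) (K th : R) (z : C) :
  geom_bounded K th a -> Cmod z <= 1 -> Cmod (psum a z) <= K / (1 - th).
Proof.
  intros Ha Hz.
  apply (is_series_C_Cmod_le _ (fun n => K * th ^ n) _ _ (is_series_psum _ _ _ _ Ha Hz)).
  - now apply is_series_geom_l, Ha.
  - intro n; rewrite Cmod_mult, Cmod_pow.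
    pose proof (pow_le_1 (Cmod z) n (conj (Cmod_ge_0 z) Hz)).
    destruct Ha as [_ Ha]; specialize (Ha n); pose proof (Cmod_ge_0 (a n)); nra.
Qed.

Lemma psum_decr (a : nat -> C) (K th : R) (z : C) :
  geom_bounded K th a -> Cmod z <= 1 ->
  psum a z = (a 0%nat + z * psum (fun n => a (S n)) z)%C.
Proof.
  intros Ha Hz.
  assert (Ha' : geom_bounded (K * th) th (fun n => a (S n))).
  { destruct Ha as [Hth Ha]; split; [exact Hth|].
    intro n; specialize (Ha (S n)); simpl in Ha; lra. }
  apply (psum_unique _ K th); auto.
  apply (is_series_decr_1 (K := C_AbsRing) (V := C_NormedModule)).
  apply (is_series_ext (K := C_AbsRing) (V := C_NormedModule)
    (fun n => scal z (Cmult (a (S n)) (Cpow z n)))).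
  { intro n; change (z * (a (S n) * z ^ n) = a (S n) * (z * z ^ n))%C; ring. }
  replace (plus _ _) with (scal z (psum (fun n => a (S n)) z)).
  - apply (is_series_scal_l (K := C_AbsRing) (V := C_NormedModule)).
    now apply (is_series_psum _ (K * th) th).
  - change (z * psum (fun n => a (S n)) z =
      a 0%nat + z * psum (fun n => a (S n)) z + - (a 0%nat * 1))%C; ring.
Qed.

Lemma geom_bounded_K_pos (a : nat -> C) (K th : R) : geom_bounded K th a -> 0 <= K.
Proof.
  intros [_ Ha]; specialize (Ha 0%nat); simpl in Ha.
  pose proof (Cmod_ge_0 (a 0%nat)); lra.
Qed.


Definition geom (a : nat -> C) : Prop := exists K th, geom_bounded K th a.

Lemma geom_lin (a b : nat -> C) (u v : C) :
  geom a -> geom b -> geom (fun n => (u * a n + v * b n)%C).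
Proof.
  intros [K [th Ha]] [K' [th' Hb]].
  pose proof (geom_bounded_K_pos _ _ _ Ha) as HK.
  pose proof (geom_bounded_K_pos _ _ _ Hb) as HK'.
  exists (Cmod u * K + Cmod v * K'), (Rmax th th'); split.
  - destruct Ha as [? _], Hb as [? _]; unfold Rmax; destruct Rle_dec; lra.
  - intro n; apply Rle_trans with (1 := Cmod_triangle _ _).
    rewrite !Cmod_mult.
    assert (Cmod (a n) <= K * Rmax th th' ^ n).
    { apply Rle_trans with (1 := proj2 Ha n), Rmult_le_compat_l; auto.
      apply pow_incr; split; [apply Ha | apply Rmax_l]. }
    assert (Cmod (b n) <= K' * Rmax th th' ^ n).
    { apply Rle_trans with (1 := proj2 Hb n), Rmult_le_compat_l; auto.
      apply pow_incr; split; [apply Hb | apply Rmax_r]. }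
    pose proof (Cmod_ge_0 u); pose proof (Cmod_ge_0 v); nra.
Qed.

Lemma psum_lin (a b : nat -> C) (u v z : C) :
  geom a -> geom b -> Cmod z <= 1 ->
  psum (fun n => (u * a n + v * b n)%C) z = (u * psum a z + v * psum b z)%C.
Proof.
  intros Ha Hb Hz.
  destruct (geom_lin _ _ u v Ha Hb) as [K'' [th'' H]].
  destruct Ha as [K [th Ha]], Hb as [K' [th' Hb]].
  apply (psum_unique _ _ _ _ _ H Hz).
  apply (is_series_ext (K := C_AbsRing) (V := C_NormedModule)
    (fun n => plus (scal u (Cmult (a n) (Cpow z n))) (scal v (Cmult (b n) (Cpow z n))))).
  { intro n.
    change (u * (a n * z ^ n) + v * (b n * z ^ n) = (u * a n + v * b n) * z ^ n)%C; ring. }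
  apply (is_series_plus (K := C_AbsRing) (V := C_NormedModule));
    apply (is_series_scal_l (K := C_AbsRing) (V := C_NormedModule)).
  - exact (is_series_psum _ _ _ _ Ha Hz).
  - exact (is_series_psum _ _ _ _ Hb Hz).
Qed.

Lemma psum_ext (a b : nat -> C) (z : C) :
  geom a -> Cmod z <= 1 -> (forall n, a n = b n) -> psum a z = psum b z.
Proof.
  intros [K [th Ha]] Hz E.
  apply (psum_unique _ K th); auto.
  apply (is_series_ext (K := C_AbsRing) (V := C_NormedModule)
    (fun n => Cmult (b n) (Cpow z n))); [now intro n; rewrite E|].
  apply (is_series_psum _ K th); auto.
  destruct Ha as [? Ha]; split; auto; intro n; rewrite <- E; auto.
Qed.

Lemma geom_shift (a : nat -> C) (m : nat) : geom a -> geom (fun n => a (m + n)%nat).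
Proof.
  intros [K [th Ha]]; pose proof (geom_bounded_K_pos _ _ _ Ha).
  destruct Ha as [Hth Ha].
  exists (K * th ^ m), th; split; [exact Hth|].
  intro n; rewrite Rmult_assoc, <- pow_add; apply Ha.
Qed.

(* Taylor coefficients of [(u + v z) h(z)], where [a] are those of [h]. *)
Definition lin_mul (u v : C) (a : nat -> C) (n : nat) : C :=
  match n with
  | O => (u * a 0%nat)%C
  | S m => (u * a (S m) + v * a m)%C
  end.

Lemma geom_cons (a : nat -> C) :
  geom (fun n => a (S n)) -> geom a.
Proof.
  intros [K [th Ha]]; pose proof (geom_bounded_K_pos _ _ _ Ha).
  destruct Ha as [Hth Ha].
  (* [th] may be 0. With a ratio of at least 1/2, moving the index by one costs at most a factor
     2. *)
  exists (Cmod (a 0%nat) + 2 * K), (Rmax th (1 / 2)).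
  assert (1 / 2 <= Rmax th (1 / 2)) by apply Rmax_r.
  assert (th <= Rmax th (1 / 2)) by apply Rmax_l.
  pose proof (Cmod_ge_0 (a 0%nat)).
  split; [unfold Rmax in *; destruct Rle_dec; lra|].
  intros [|n]; [simpl; lra|].
  apply Rle_trans with (1 := Ha n); simpl.
  assert (th ^ n <= Rmax th (1 / 2) ^ n) by (apply pow_incr; lra).
  assert (0 <= th ^ n) by (apply pow_le; lra).
  assert (0 <= Cmod (a 0%nat) * (Rmax th (1 / 2) * Rmax th (1 / 2) ^ n)).
  { repeat apply Rmult_le_pos; lra. }
  assert (K * th ^ n <= K * (2 * (Rmax th (1 / 2) * Rmax th (1 / 2) ^ n))).
  { apply Rmult_le_compat_l; nra. }
  lra.
Qed.

Lemma geom_lin_mul (u v : C) (a : nat -> C) : geom a -> geom (lin_mul u v a).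
Proof.
  intro Ha; apply geom_cons; simpl.
  apply (geom_lin (fun n => a (S n)) a); auto.
  exact (geom_shift a 1 Ha).
Qed.

Lemma psum_lin_mul (u v z : C) (a : nat -> C) :
  geom a -> Cmod z <= 1 -> psum (lin_mul u v a) z = ((u + v * z) * psum a z)%C.
Proof.
  intros Ha Hz.
  destruct (geom_lin_mul u v a Ha) as [K [th H]].
  rewrite (psum_decr _ _ _ _ H Hz); simpl.
  pose proof (geom_shift a 1 Ha) as Ha1; simpl in Ha1.
  rewrite (psum_lin (fun n => a (S n)) a); auto.
  destruct Ha as [K' [th' Ha]].
  rewrite (psum_decr _ _ _ _ Ha Hz); ring.
Qed.

(* Taylor coefficients at 0 of [z |-> (h(z) - h(w)) / (z - w)]. *)
Definition diff_quot (a : nat -> C) (w : C) (n : nat) : C :=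
  psum (fun j => a (S n + j)%nat) w.

Lemma geom_bounded_diff_quot (K th : R) (a : nat -> C) (w : C) :
  geom_bounded K th a -> Cmod w <= 1 ->
  geom_bounded (K / (1 - th)) th (diff_quot a w).
Proof.
  intros Ha Hw; pose proof (geom_bounded_K_pos _ _ _ Ha) as HK.
  destruct Ha as [Hth Ha]; split; [exact Hth|].
  intro n; unfold diff_quot.
  replace (K / (1 - th) * th ^ n) with (K * th ^ n / (1 - th)) by (field; lra).
  apply psum_bound; auto; split; [exact Hth|].
  intro j; apply Rle_trans with (1 := Ha _).
  rewrite Rmult_assoc, <- pow_add.
  apply Rmult_le_compat_l; auto; simpl.
  pose proof (pow_le_1 th (n + j)); nra.
Qed.

Lemma geom_diff_quot (a : nat -> C) (w : C) :
  geom a -> Cmod w <= 1 -> geom (diff_quot a w).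
Proof.
  intros [K [th Ha]] Hw; exists (K / (1 - th)), th.
  now apply geom_bounded_diff_quot.
Qed.

(** Consecutive tails satisfy [d n = a (S n) + w * d (S n)] for [d = diff_quot a w], so
    multiplication by [z - w] telescopes. *)
Lemma lin_mul_diff_quot (a : nat -> C) (w : C) (n : nat) :
  geom a -> Cmod w <= 1 ->
  lin_mul (- w) 1 (diff_quot a w) n =
  match n with O => (a 0%nat - psum a w)%C | S m => a (S m) end.
Proof.
  intros Ha Hw; destruct n as [|n]; unfold diff_quot; cbn [lin_mul].
  - destruct Ha as [K [th Ha]].
    rewrite (psum_decr _ _ _ w Ha Hw); change (fun j => a (1 + j)%nat) with (fun j => a (S j)); ring.
  - rewrite (psum_ext (fun j => a (S (S n) + j)%nat) (fun j => a (S n + S j)%nat) w);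
      auto using geom_shift.
    + destruct (geom_shift a (S n) Ha) as [K [th H]].
      rewrite (psum_decr (fun j => a (S n + j)%nat) K th w H Hw), Nat.add_0_r; ring.
    + intro j; f_equal; lia.
Qed.

Lemma psum_diff_quot (a : nat -> C) (z w : C) :
  geom a -> Cmod z <= 1 -> Cmod w <= 1 ->
  (psum a z - psum a w = (z - w) * psum (diff_quot a w) z)%C.
Proof.
  intros Ha Hz Hw.
  pose proof (geom_diff_quot a w Ha Hw) as Hd.
  replace (z - w)%C with (- w + 1 * z)%C by ring.
  rewrite <- psum_lin_mul; auto.
  destruct (geom_lin_mul (- w) 1 _ Hd) as [K [th H]].
  rewrite (psum_decr _ _ _ z H Hz).
  rewrite (lin_mul_diff_quot a w 0); auto.
  rewrite (psum_ext (fun n => lin_mul (- w) 1 (diff_quot a w) (S n))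
    (fun n => a (S n)) z); auto.
  - destruct Ha as [K' [th' Ha]].
    rewrite (psum_decr _ _ _ z Ha Hz); ring.
  - exact (geom_shift _ 1 (geom_lin_mul (- w) 1 _ Hd)).
  - intro n; now apply (lin_mul_diff_quot a w (S n)).
Qed.

(** * Mean values of holomorphic functions over roots of unity *)

Lemma Cmod_mult_le (x y : C) (A B : R) :
  Cmod x <= A -> Cmod y <= B -> Cmod (x * y)%C <= A * B.
Proof.
  intros; rewrite Cmod_mult; apply Rmult_le_compat; auto; apply Cmod_ge_0.
Qed.

Lemma Cmod_plus_le (x y : C) (A B : R) :
  Cmod x <= A -> Cmod y <= B -> Cmod (x + y)%C <= A + B.
Proof. intros; pose proof (Cmod_triangle x y); lra. Qed.

Lemma Cmod_minus_le (x y : C) (A B : R) :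
  Cmod x <= A -> Cmod y <= B -> Cmod (x - y)%C <= A + B.
Proof. intros; apply Cmod_plus_le; rewrite ?Cmod_opp; auto. Qed.

(* [C^{1,1}] holomorphy on the closed disk of radius [kap], in a form
   which only involves difference estimates. *)
Definition smooth (kap : R) (H : C -> C) : Prop :=
  exists (H' : C -> C) (K : R), forall z w : C, Cmod z <= kap -> Cmod w <= kap ->
    Cmod (H z) <= K /\
    Cmod (H w - H z)%C <= K * Cmod (w - z)%C /\
    Cmod (H w - H z - (w - z) * H' z)%C <= K * Cmod (w - z)%C ^ 2.

Lemma smooth_const (kap : R) (c : C) : smooth kap (fun _ => c).
Proof.
  exists (fun _ => 0%C), (Cmod c); intros z w _ _.
  replace (c - c - (w - z) * 0)%C with (RtoC 0) by ring.
  replace (c - c)%C with (RtoC 0) by ring.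
  rewrite Cmod_0; pose proof (Cmod_ge_0 c); pose proof (Cmod_ge_0 (w - z)).
  repeat split; nra.
Qed.

Lemma smooth_id (kap : R) : smooth kap (fun z => z).
Proof.
  exists (fun _ => 1%C), (Rmax kap 1); intros z w Hz Hw.
  replace (w - z - (w - z) * 1)%C with (RtoC 0) by ring.
  rewrite Cmod_0; pose proof (Cmod_ge_0 (w - z)).
  pose proof (Rmax_l kap 1); pose proof (Rmax_r kap 1).
  repeat split; nra.
Qed.

Lemma smooth_plus (kap : R) (H J : C -> C) :
  smooth kap H -> smooth kap J -> smooth kap (fun z => H z + J z)%C.
Proof.
  intros [H' [K HK]] [J' [L HL]].
  exists (fun z => H' z + J' z)%C, (K + L); intros z w Hz Hw.
  destruct (HK z w Hz Hw) as [H1 [H2 H3]], (HL z w Hz Hw) as [J1 [J2 J3]].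
  rewrite !Rmult_plus_distr_r; repeat split.
  - now apply Cmod_plus_le.
  - replace (H w + J w - (H z + J z))%C with ((H w - H z) + (J w - J z))%C by ring.
    now apply Cmod_plus_le.
  - replace (_ - _)%C with ((H w - H z - (w - z) * H' z) + (J w - J z - (w - z) * J' z))%C
      by ring.
    now apply Cmod_plus_le.
Qed.

Lemma smooth_mult (kap : R) (H J : C -> C) :
  smooth kap H -> smooth kap J -> smooth kap (fun z => H z * J z)%C.
Proof.
  intros [H' [K HK]] [J' [L HL]].
  exists (fun z => H' z * J z + H z * J' z)%C, (3 * (K * L)).
  intros z w Hz Hw.
  destruct (HK z w Hz Hw) as [H1 [H2 H3]], (HL z w Hz Hw) as [J1 [J2 J3]].
  destruct (HL w z Hw Hz) as [J1' _].
  pose proof (Cmod_ge_0 (w - z)) as Hd; pose proof (Cmod_ge_0 (H z)) as HH.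
  pose proof (Cmod_ge_0 (J z)) as HJ.
  assert (0 <= K * L) by (apply Rmult_le_pos; lra).
  assert (0 <= K * L * Cmod (w - z)) by (apply Rmult_le_pos; lra).
  repeat split.
  - apply Rle_trans with (K * L); [now apply Cmod_mult_le | lra].
  - replace (H w * J w - H z * J z)%C with ((H w - H z) * J w + H z * (J w - J z))%C by ring.
    apply Rle_trans with (K * Cmod (w - z) * L + K * (L * Cmod (w - z))); [|lra].
    apply Cmod_plus_le; apply Cmod_mult_le; auto.
  - replace (_ - _)%C with ((H w - H z) * (J w - J z) + J z * (H w - H z - (w - z) * H' z)
      + H z * (J w - J z - (w - z) * J' z))%C by ring.
    apply Rle_trans with (K * Cmod (w - z) * (L * Cmod (w - z))
      + L * (K * Cmod (w - z) ^ 2) + K * (L * Cmod (w - z) ^ 2)).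
    + repeat apply Cmod_plus_le; apply Cmod_mult_le; auto.
    + apply Req_le; ring.
Qed.

Lemma smooth_pow (kap : R) (n : nat) : smooth kap (fun z => (z ^ n)%C).
Proof.
  induction n as [|n IH]; simpl; [apply smooth_const|].
  apply smooth_mult; auto; apply smooth_id.
Qed.

Lemma smooth_inv (kap m : R) (H : C -> C) :
  0 < m -> (forall z, Cmod z <= kap -> m <= Cmod (H z)) ->
  smooth kap H -> smooth kap (fun z => / H z)%C.
Proof.
  intros Hm Hmin [H' [K HK]].
  assert (H0 : forall z, Cmod z <= kap -> H z <> 0%C).
  { intros z Hz E; specialize (Hmin z Hz); rewrite E, Cmod_0 in Hmin; lra. }
  assert (Hi : forall z, Cmod z <= kap -> Cmod (/ H z) <= / m).
  { intros z Hz; rewrite Cmod_inv; auto.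
    apply Rinv_le_contravar; auto. }
  assert (Hm' : 0 < / m) by now apply Rinv_0_lt_compat.
  exists (fun z => - (H' z * (/ H z * / H z)))%C,
    (/ m + K * (/ m * / m) + K * K * (/ m * / m * / m)).
  intros z w Hz Hw.
  destruct (HK z w Hz Hw) as [H1 [H2 H3]].
  pose proof (Cmod_ge_0 (w - z)) as Hd; pose proof (Cmod_ge_0 (H z)) as HH.
  assert (HK0 : 0 <= K) by lra.
  assert (0 <= / m * / m) by nra.
  assert (0 <= K * (/ m * / m)) by (apply Rmult_le_pos; lra).
  assert (0 <= K * K * (/ m * / m * / m)).
  { apply Rmult_le_pos; [nra|]; apply Rmult_le_pos; lra. }
  assert (Hzz : Cmod (/ H z * / H z) <= / m * / m) by (apply Cmod_mult_le; auto).
  assert (Hzw : Cmod (/ H z * / H w) <= / m * / m) by (apply Cmod_mult_le; auto).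
  assert (Hzzw : Cmod (/ H z * / H z * / H w) <= / m * / m * / m)
    by (apply Cmod_mult_le; auto).
  repeat split.
  - apply Rle_trans with (1 := Hi z Hz); lra.
  - replace (/ H w - / H z)%C with (- ((H w - H z) * (/ H z * / H w)))%C
      by (field; auto).
    rewrite Cmod_opp.
    apply Rle_trans with (K * Cmod (w - z) * (/ m * / m)).
    + now apply Cmod_mult_le.
    + replace (K * Cmod (w - z) * (/ m * / m))
        with (K * (/ m * / m) * Cmod (w - z)) by ring.
      apply Rmult_le_compat_r; lra.
  (* The second-order remainder of [1/H] is the square of the first difference over [H(z)^2 H(w)],
     minus the remainder of [H] over [H(z)^2]. *)
  - replace (_ - _)%C with ((H w - H z) * (H w - H z) * (/ H z * / H z * / H w)
      - (H w - H z - (w - z) * H' z) * (/ H z * / H z))%C by (field; auto).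
    apply Rle_trans with (K * Cmod (w - z) * (K * Cmod (w - z)) * (/ m * / m * / m)
      + K * Cmod (w - z) ^ 2 * (/ m * / m)).
    + apply Cmod_minus_le; apply Cmod_mult_le; auto; now apply Cmod_mult_le.
    + replace (_ + _) with ((K * (/ m * / m) + K * K * (/ m * / m * / m)) * Cmod (w - z) ^ 2)
        by ring.
      apply Rmult_le_compat_r; [apply pow2_ge_0 | lra].
Qed.

(** The derivative at [z] is the difference quotient at [z] evaluated at [z], and the second-order
    remainder is [(w - z)^2] times an iterated difference quotient. Each difference quotient costs a
    factor [1 / (1 - th)], whence the powers of [q]. *)
Lemma smooth_psum (kap : R) (a : nat -> C) : kap <= 1 -> geom a -> smooth kap (psum a).
Proof.
  intros Hkap [K [th Ha]].
  pose proof (geom_bounded_K_pos _ _ _ Ha) as HK.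
  assert (Hth : 0 < 1 - th) by (destruct Ha as [? _]; lra).
  set (q := / (1 - th)).
  assert (Hq : 0 < q) by now apply Rinv_0_lt_compat.
  exists (fun z => psum (diff_quot a z) z), (K * q + K * q * q + K * q * q * q).
  intros z w Hz Hw.
  assert (Hz1 : Cmod z <= 1) by lra; assert (Hw1 : Cmod w <= 1) by lra.
  pose proof (geom_bounded_diff_quot _ _ _ z Ha Hz1) as Ha1.
  pose proof (geom_bounded_diff_quot _ _ _ z Ha1 Hz1) as Ha2.
  pose proof (psum_bound _ _ _ z Ha Hz1) as B0.
  pose proof (psum_bound _ _ _ w Ha1 Hw1) as B1.
  pose proof (psum_bound _ _ _ w Ha2 Hw1) as B2.
  unfold Rdiv in B0, B1, B2; fold q in B0, B1, B2.
  assert (0 <= K * q) by nra.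
  assert (0 <= K * q * q) by nra.
  assert (0 <= K * q * q * q) by nra.
  assert (E1 : (psum a w - psum a z = (w - z) * psum (diff_quot a z) w)%C).
  { apply psum_diff_quot; auto; now exists K, th. }
  assert (E2 : (psum (diff_quot a z) w - psum (diff_quot a z) z =
    (w - z) * psum (diff_quot (diff_quot a z) z) w)%C).
  { apply psum_diff_quot; auto; now exists (K / (1 - th)), th. }
  pose proof (Cmod_ge_0 (w - z)) as Hd.
  repeat split.
  - lra.
  - rewrite E1, Cmod_mult; nra.
  - rewrite E1.
    replace (_ - _)%C with ((w - z) * (psum (diff_quot a z) w - psum (diff_quot a z) z))%C
      by ring.
    rewrite E2, !Cmod_mult; pose proof (pow2_ge_0 (Cmod (w - z))); simpl in *; nra.
Qed.

(** * Finite complex sums and sampling at roots of unity *)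

Definition Csum (u : nat -> C) (n : nat) : C := @sum_n C_AbelianGroup u n.

Lemma Csum_O (u : nat -> C) : Csum u 0 = u 0%nat.
Proof. exact (@sum_O C_AbelianGroup u). Qed.

Lemma Csum_Sn (u : nat -> C) (n : nat) : Csum u (S n) = (Csum u n + u (S n))%C.
Proof. exact (@sum_Sn C_AbelianGroup u n). Qed.

Lemma Csum_ext (u v : nat -> C) (n : nat) :
  (forall j, u j = v j) -> Csum u n = Csum v n.
Proof. exact (@sum_n_ext C_AbelianGroup u v n). Qed.

Lemma Csum_Cmod_le (u : nat -> C) (b : R) (n : nat) :
  (forall j, (j <= n)%nat -> Cmod (u j) <= b) -> Cmod (Csum u n) <= INR (S n) * b.
Proof.
  intro Hu; induction n as [|n IH].
  - rewrite Csum_O; simpl; rewrite Rmult_1_l; apply Hu; lia.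
  - rewrite Csum_Sn, S_INR, Rmult_plus_distr_r, Rmult_1_l.
    apply Cmod_plus_le; [apply IH; intros; apply Hu; lia | apply Hu; lia].
Qed.

Lemma Csum_telescope (u : nat -> C) (n : nat) :
  Csum (fun j => u (S j) - u j)%C n = (u (S n) - u 0%nat)%C.
Proof.
  induction n as [|n IH]; [now rewrite Csum_O|].
  rewrite Csum_Sn, IH; ring.
Qed.

Lemma Csum_mult_l (c : C) (u : nat -> C) (n : nat) :
  Csum (fun j => c * u j)%C n = (c * Csum u n)%C.
Proof. exact (sum_n_mult_l (K := C_Ring) c u n). Qed.

Lemma Csum_minus (u v : nat -> C) (n : nat) :
  Csum (fun j => u j - v j)%C n = (Csum u n - Csum v n)%C.
Proof.
  induction n as [|n IH]; [now rewrite !Csum_O|].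
  rewrite !Csum_Sn, IH; ring.
Qed.

Lemma Csum_const (c : C) (n : nat) : Csum (fun _ => c) n = (INR (S n) * c)%C.
Proof.
  induction n as [|n IH]; [rewrite Csum_O; simpl; ring|].
  rewrite Csum_Sn, IH, (S_INR (S n)), RtoC_plus; ring.
Qed.

(** The order is [S n], the number of terms of a sum up to [n]. *)
Definition root_angle (n : nat) : R := 2 * PI / INR (S n).
Definition root (n : nat) : C := (cos (root_angle n), sin (root_angle n)).

Lemma de_moivre (t : R) (k : nat) :
  Cpow (cos t, sin t) k = (cos (INR k * t), sin (INR k * t)).
Proof.
  induction k as [|k IH].
  - simpl; rewrite Rmult_0_l, cos_0, sin_0; reflexivity.
  - rewrite S_INR, Rmult_plus_distr_r, Rmult_1_l, cos_plus, sin_plus.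
    simpl; rewrite IH; unfold Cmult; simpl; f_equal; ring.
Qed.

Lemma root_pow (n : nat) : (root n ^ S n = 1)%C.
Proof.
  unfold root; rewrite de_moivre; unfold root_angle.
  replace (INR (S n) * (2 * PI / INR (S n))) with (2 * PI)
    by (field; apply not_0_INR; lia).
  now rewrite cos_2PI, sin_2PI.
Qed.

Lemma Cmod_root_pow (n j : nat) : Cmod (root n ^ j) = 1.
Proof.
  rewrite Cmod_pow.
  replace (Cmod (root n)) with 1; [apply pow1|].
  unfold Cmod, root; simpl fst; simpl snd.
  pose proof (sin2_cos2 (root_angle n)) as E; unfold Rsqr in E.
  replace (_ + _) with 1 by (simpl; lra); now rewrite sqrt_1.
Qed.

Lemma root_angle_pos (n : nat) : 0 < root_angle n.
Proof.
  pose proof PI_RGT_0; pose proof (lt_0_INR (S n) (Nat.lt_0_succ n)).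
  apply Rdiv_lt_0_compat; lra.
Qed.

(** A chord is no longer than its arc: [|root n - 1| = 2 |sin (t/2)|]. *)
Lemma Cmod_root_minus_1 (n : nat) : Cmod (root n - 1) <= root_angle n.
Proof.
  pose proof (root_angle_pos n) as Hp.
  set (t := root_angle n) in *.
  assert (E : Cmod (root n - 1) ^ 2 = (2 * sin (t / 2)) ^ 2).
  { rewrite Cmod2_alt; unfold root; fold t; simpl.
    pose proof (sin2_cos2 t) as E1; unfold Rsqr in E1.
    assert (E2 : cos t = 1 - 2 * sin (t / 2) * sin (t / 2)).
    { rewrite <- cos_2a_sin; f_equal; field. }
    replace (_ + _) with (2 - 2 * cos t) by nra.
    rewrite E2; ring. }
  assert (Hs : sin (t / 2) < t / 2) by (apply sin_lt_x; lra).
  assert (Hs' : - (t / 2) < sin (t / 2)).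
  { destruct (Rle_lt_dec t PI) as [Ht|Ht].
    - pose proof (sin_ge_0 (t / 2)); pose proof PI_RGT_0; lra.
    - pose proof (SIN_bound (t / 2)); pose proof PI2_1; unfold PI2 in *; lra. }
  pose proof (Cmod_ge_0 (root n - 1)); simpl in E; nra.
Qed.

(** From order 3 on the angle lies strictly between 0 and [PI], where the sine is positive. *)
Lemma Cmod_root_minus_1_pos (n : nat) : (2 <= n)%nat -> 0 < Cmod (root n - 1).
Proof.
  intro Hn; apply Cmod_gt_0; intro E.
  assert (Ht : 0 < sin (root_angle n)).
  { apply sin_gt_0; [apply root_angle_pos|].
    unfold root_angle; pose proof PI_RGT_0.
    assert (3 <= INR (S n)).
    { replace 3 with (INR 3) by (simpl; ring); apply le_INR; lia. }
    apply Rmult_lt_reg_r with (INR (S n)); [lra|].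
    unfold Rdiv; rewrite Rmult_assoc, Rinv_l by lra; nra. }
  apply (f_equal snd) in E; unfold root in E; simpl in E; lra.
Qed.

(** A mean value inequality without integration: cutting [[0, kap]] into steps of length [d] makes
    the quadratic errors add up to [B * kap * d], which tends to 0 with [d]. *)
Lemma small_steps (G : R -> C) (kap L B : R) :
  0 <= kap -> 0 <= B ->
  (forall s d, 0 <= s -> 0 <= d -> s + d <= kap ->
    Cmod (G (s + d) - G s) <= L * d + B * d ^ 2) ->
  Cmod (G kap - G 0) <= L * kap.
Proof.
  intros Hk HB Hstep.
  apply le_epsilon; intros eps Heps.
  destruct (INR_archimed eps (B * kap ^ 2) Heps) as [N HN].
  assert (HN1 : 0 < INR (S N)) by (apply lt_0_INR; lia).
  set (d := kap / INR (S N)).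
  assert (Hd : 0 <= d) by (apply Rdiv_le_0_compat; lra).
  assert (Ed : INR (S N) * d = kap) by (unfold d; field; lra).
  assert (Hind : forall k, (k <= S N)%nat ->
    Cmod (G (INR k * d) - G 0) <= INR k * (L * d + B * d ^ 2)).
  { induction k as [|k IH]; intro Hkle.
    - simpl; rewrite !Rmult_0_l.
      replace (G 0%R - G 0%R)%C with (RtoC 0) by ring; rewrite Cmod_0; lra.
    - specialize (IH ltac:(lia)).
      assert (Hkd : INR (S k) * d <= kap).
      { rewrite <- Ed; apply Rmult_le_compat_r; auto; now apply le_INR. }
      rewrite S_INR, Rmult_plus_distr_r, Rmult_1_l in Hkd |- *.
      rewrite Rmult_plus_distr_r, Rmult_1_l.
      replace (_ - _)%C with ((G (INR k * d)%R - G 0%R) + (G (INR k * d + d)%R - G (INR k * d)%R))%C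
        by ring.
      apply Cmod_plus_le; auto.
      apply Hstep; auto; apply Rmult_le_pos; auto; apply pos_INR. }
  specialize (Hind (S N) (Nat.le_refl _)); rewrite Ed in Hind.
  apply Rle_trans with (1 := Hind).
  replace (INR (S N) * (L * d + B * d ^ 2)) with (L * (INR (S N) * d) + B * (INR (S N) * d) * d)
    by ring.
  rewrite Ed.
  assert (B * kap * d <= eps); [|lra].
  apply Rmult_le_reg_l with (INR (S N)); auto.
  replace (INR (S N) * (B * kap * d)) with (B * kap * (INR (S N) * d)) by ring.
  rewrite Ed, S_INR; nra.
Qed.

(** The mean value property with error O(1/n), since [B] does not depend on [n]. The radial
    derivative [E s] of the sample sum [G s] is bounded uniformly in [n], because [s (w - 1) E s]
    equals, up to sign, a sum of second-order remainders; [small_steps] then carries the bound from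
    radius 0 to [kap]. *)
Lemma circle_sum (kap : R) (H : C -> C) :
  0 <= kap -> smooth kap H ->
  exists B : R, forall n : nat, (2 <= n)%nat ->
    Cmod (Csum (fun j => H (kap * root n ^ j)%C) n - INR (S n) * H 0%C) <= B.
Proof.
  intros Hk [H' [K HK]].
  assert (HK0 : 0 <= K).
  { destruct (HK 0%C 0%C) as [H1 _]; rewrite ?Cmod_0; auto.
    pose proof (Cmod_ge_0 (H 0%C)); lra. }
  exists (2 * PI * K * kap * kap); intros n Hn.
  set (w := root n).
  set (G := fun s : R => Csum (fun j => H (s * w ^ j)%C) n).
  set (E := fun s : R => Csum (fun j => (w ^ j * H' (s * w ^ j))%C) n).
  assert (Hmod : forall (s : R) j, 0 <= s -> Cmod (s * w ^ j)%C = s).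
  { intros s j Hs; unfold w; rewrite Cmod_mult, Cmod_root_pow, Cmod_R, Rabs_pos_eq; lra. }
  pose proof (lt_0_INR (S n) (Nat.lt_0_succ n)) as HnR.
  pose proof (Cmod_root_minus_1_pos n Hn) as Hw; fold w in Hw.
  pose proof (Cmod_root_minus_1 n) as Hw'; fold w in Hw'.
  (* Rotating the sample points by one step does not change the sum of [H]. *)
  assert (HE : forall s, 0 <= s <= kap -> Cmod (E s) <= 2 * PI * K * kap).
  { intros s [Hs0 Hs].
    (* There are [S n] remainders of order [|w - 1|^2]. After division by [|w - 1|] exactly this
       product is left. *)
    assert (Hwn : INR (S n) * Cmod (w - 1) <= 2 * PI).
    { replace (2 * PI) with (INR (S n) * root_angle n)
        by (unfold root_angle; field; lra).
      apply Rmult_le_compat_l; lra. }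
    (* At [s = 0] one cannot divide by [s]; there [E 0] vanishes because the roots of unity sum to
       0. *)
    destruct (Req_dec s 0) as [->|Hs'].
    { replace (E 0) with (RtoC 0).
      { rewrite Cmod_0; pose proof PI_RGT_0; apply Rmult_le_pos; auto.
        apply Rmult_le_pos; lra. }
      assert (Ew : ((w - 1) * Csum (fun j => w ^ j)%C n = 0)%C).
      { rewrite <- Csum_mult_l.
        transitivity (Csum (fun j => w ^ S j - w ^ j)%C n).
        - apply Csum_ext; intro j; simpl; ring.
        - rewrite (Csum_telescope (fun j => (w ^ j)%C)); unfold w; rewrite root_pow; simpl; ring. }
      assert (Ew' : Csum (fun j => w ^ j)%C n = 0%C).
      { apply Cmod_eq_0; apply (f_equal Cmod) in Ew.
        rewrite Cmod_mult, Cmod_0 in Ew; nra. }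
      symmetry; unfold E.
      transitivity (Csum (fun j => H' 0 * w ^ j)%C n).
      - apply Csum_ext; intro j.
        rewrite Cmult_0_l; apply Cmult_comm.
      - rewrite (Csum_mult_l (H' 0%C) (fun j => (w ^ j)%C)), Ew'; ring. }
    assert (Hrot : (s * (w - 1) * E s)%C =
      (- Csum (fun j => H (s * w ^ S j) - H (s * w ^ j)
                - (s * w ^ S j - s * w ^ j) * H' (s * w ^ j))%C n)%C).
    { rewrite (Csum_minus (fun j => H (s * w ^ S j) - H (s * w ^ j))%C).
      rewrite (Csum_telescope (fun j => H (s * w ^ j)%C)).
      replace (w ^ S n)%C with (RtoC 1) by (symmetry; apply root_pow).
      unfold E; rewrite <- Csum_mult_l.
      rewrite (Csum_ext
        (fun j => (s * (w - 1) * (w ^ j * H' (s * w ^ j)))%C)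
        (fun j => ((s * w ^ S j - s * w ^ j) * H' (s * w ^ j))%C))
        by (intro j; simpl; ring).
      simpl; ring. }
    assert (Hle : s * Cmod (w - 1) * Cmod (E s) <= INR (S n) * (K * (s * Cmod (w - 1)) ^ 2)).
    { replace (s * Cmod (w - 1) * Cmod (E s)) with (Cmod (s * (w - 1) * E s)%C)
        by (rewrite !Cmod_mult, Cmod_R, Rabs_pos_eq; auto).
      rewrite Hrot, Cmod_opp; apply Csum_Cmod_le; intros j _.
      destruct (HK (s * w ^ j)%C (s * w ^ S j)%C) as [_ [_ H3]];
        rewrite ?Hmod; auto.
      replace (s * Cmod (w - 1)) with (Cmod (s * w ^ S j - s * w ^ j)); auto.
      simpl; replace (s * (w * w ^ j) - s * w ^ j)%C with (s * w ^ j * (w - 1))%C by ring.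
      now rewrite Cmod_mult, Hmod. }
    assert (Hpos : 0 < s * Cmod (w - 1)) by (apply Rmult_lt_0_compat; lra).
    apply Rle_trans with (K * s * (INR (S n) * Cmod (w - 1))).
    - apply Rmult_le_reg_l with (1 := Hpos).
      apply Rle_trans with (1 := Hle), Req_le; ring.
    - apply Rle_trans with (K * s * (2 * PI)).
      + apply Rmult_le_compat_l; auto; apply Rmult_le_pos; lra.
      + replace (2 * PI * K * kap) with (2 * PI * (K * kap)) by ring.
        replace (K * s * (2 * PI)) with (2 * PI * (K * s)) by ring.
        pose proof PI_RGT_0.
        apply Rmult_le_compat_l; [lra|]; apply Rmult_le_compat_l; lra. }
  replace (Csum _ n - _)%C with (G kap - G 0)%C.
  - apply (small_steps G kap (2 * PI * K * kap) (INR (S n) * K)); auto.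
    + apply Rmult_le_pos; lra.
    + intros s d Hs Hd Hsd.
      replace (G (s + d)%R - G s)%C with (d * E s
        + Csum (fun j => H ((s + d)%R * w ^ j) - H (s * w ^ j)
                - ((s + d)%R * w ^ j - s * w ^ j) * H' (s * w ^ j))%C n)%C.
      * apply Cmod_plus_le.
        -- rewrite Cmod_mult, Cmod_R, Rabs_pos_eq by auto; rewrite Rmult_comm.
           apply Rmult_le_compat_r; auto; apply HE; lra.
        -- rewrite Rmult_assoc; apply Csum_Cmod_le; intros j _.
           destruct (HK (s * w ^ j)%C ((s + d)%R * w ^ j)%C) as [_ [_ H3]];
             rewrite ?Hmod; try lra.
           apply Rle_trans with (1 := H3), Req_le.
           replace ((s + d)%R * w ^ j - s * w ^ j)%C with (d * w ^ j)%C
             by (rewrite RtoC_plus; ring).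
           now rewrite Hmod.
      * rewrite (Csum_minus (fun j => H ((s + d)%R * w ^ j) - H (s * w ^ j))%C).
        rewrite (Csum_minus (fun j => H ((s + d)%R * w ^ j))%C).
        unfold E; rewrite <- Csum_mult_l.
        rewrite (Csum_ext
          (fun j => (d * (w ^ j * H' (s * w ^ j)))%C)
          (fun j => (((s + d)%R * w ^ j - s * w ^ j) * H' (s * w ^ j))%C))
          by (intro j; rewrite RtoC_plus; ring).
        unfold G; ring.
  - unfold G; f_equal; f_equal; rewrite <- Csum_const.
    apply Csum_ext; intro j; now rewrite Cmult_0_l.
Qed.

(** * Contraction by a zero-free quotient *)

Lemma Cmod2_plus (x y : C) :
  Cmod (x + y) ^ 2 = Cmod x ^ 2 + Cmod y ^ 2 + 2 * Re (Cconj x * y).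
Proof. rewrite !Cmod2_alt; destruct x, y; simpl; ring. Qed.

Lemma Re_Csum (u : nat -> C) (n : nat) : Re (Csum u n) = sum_f_R0 (fun j => Re (u j)) n.
Proof.
  induction n as [|n IH]; [now rewrite Csum_O|].
  rewrite Csum_Sn, tech5, <- IH; reflexivity.
Qed.

(** A mean square multiplied by the number [S n] of sample points; without the division the errors
    stay bounded uniformly in [n]. *)
Definition circle_sq (kap : R) (n : nat) (H : C -> C) : R :=
  sum_f_R0 (fun j => Cmod (H (kap * root n ^ j)%C) ^ 2) n.

Lemma Cmod_circle (kap : R) (n j : nat) : 0 <= kap -> Cmod (kap * root n ^ j)%C = kap.
Proof. intros; rewrite Cmod_mult, Cmod_root_pow, Cmod_R, Rabs_pos_eq; lra. Qed.

(** The constant [c] is orthogonal to [z J(z)]: the cross terms sum to the real part of twice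
    [Cconj c] times a sample sum of [z J(z)], which [circle_sum] bounds because this function
    vanishes at 0. *)
Lemma circle_sq_decr (kap : R) (H J : C -> C) (c : C) :
  0 <= kap -> smooth kap J ->
  (forall z, Cmod z <= kap -> H z = c + z * J z)%C ->
  exists B, forall n, (2 <= n)%nat ->
    Rabs (circle_sq kap n H - (INR (S n) * Cmod c ^ 2 + kap ^ 2 * circle_sq kap n J)) <= B.
Proof.
  intros Hk HJ E.
  destruct (circle_sum kap (fun z => z * J z)%C Hk) as [B HB].
  { apply smooth_mult; auto; apply smooth_id. }
  exists (2 * (Cmod c * B)); intros n Hn.
  replace (_ - _) with (2 * Re (Cconj c *
    Csum (fun j => (kap * root n ^ j) * J (kap * root n ^ j))%C n)).
  - rewrite Rabs_mult, (Rabs_pos_eq 2) by lra.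
    apply Rmult_le_compat_l; [lra|].
    apply Rle_trans with (1 := re_le_Cmod _).
    rewrite Cmod_mult, Cmod_conj.
    apply Rmult_le_compat_l; [apply Cmod_ge_0|].
    specialize (HB n Hn); rewrite Cmult_0_l, Cmult_0_r in HB.
    unfold Cminus in HB; now rewrite Copp_0, Cplus_0_r in HB.
  - rewrite <- Csum_mult_l, Re_Csum.
    unfold circle_sq.
    rewrite (sum_eq (fun j => Cmod (H (kap * root n ^ j)%C) ^ 2)
      (fun j => Cmod c ^ 2 + Cmod (J (kap * root n ^ j)%C) ^ 2 * kap ^ 2
        + Re (Cconj c * (kap * root n ^ j * J (kap * root n ^ j)))%C * 2)).
    + rewrite !plus_sum, sum_cte, <- !scal_sum; ring.
    + intros j _; rewrite E by (rewrite Cmod_circle; lra).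
      rewrite (Cmod2_plus c), Cmod_mult, Cmod_circle by auto; ring.
Qed.

(** [F k] plays the k-th Taylor remainder of [F 0] and [d k] its k-th coefficient. Iterating
    [circle_sq_decr] and dropping the nonnegative last mean square gives Bessel's inequality. *)
Lemma circle_bessel (kap : R) (N : nat) :
  0 <= kap -> forall (F : nat -> C -> C) (d : nat -> C),
  (forall k, smooth kap (F k)) ->
  (forall k z, Cmod z <= kap -> F k z = d k + z * F (S k) z)%C ->
  exists B, forall n, (2 <= n)%nat ->
    INR (S n) * sum_f_R0 (fun k => Cmod (d k) ^ 2 * (kap ^ 2) ^ k) N
      <= circle_sq kap n (F 0%nat) + B.
Proof.
  intro Hk; induction N as [|N IH]; intros F d HF E;
    destruct (circle_sq_decr kap (F 0%nat) (F 1%nat) (d 0%nat) Hk (HF 1%nat)) as [B HB];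
    auto.
  - exists B; intros n Hn; specialize (HB n Hn); simpl sum_f_R0.
    assert (0 <= kap ^ 2 * circle_sq kap n (F 1%nat)).
    { apply Rmult_le_pos; [apply pow2_ge_0|].
      apply cond_pos_sum; intro; apply pow2_ge_0. }
    apply Rabs_le_between in HB; simpl in *; lra.
  - destruct (IH (fun k => F (S k)) (fun k => d (S k))) as [B' HB']; auto.
    exists (B + kap ^ 2 * B'); intros n Hn.
    specialize (HB n Hn); specialize (HB' n Hn).
    rewrite decomp_sum by lia; cbn [pred].
    replace (sum_f_R0 (fun i => Cmod (d (S i)) ^ 2 * (kap ^ 2) ^ S i) N)
      with (kap ^ 2 * sum_f_R0 (fun i => Cmod (d (S i)) ^ 2 * (kap ^ 2) ^ i) N)
      by (rewrite scal_sum; apply sum_eq; intros; simpl; ring).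
    apply Rabs_le_between in HB.
    pose proof (pow2_ge_0 kap) as Hk2.
    apply (Rmult_le_compat_l _ _ _ Hk2) in HB'.
    rewrite pow_O, Rmult_1_r; lra.
Qed.

(** Compactness together with a Lipschitz bound: near a point with [H <> 0] the modulus stays
    bounded below. *)
Lemma smooth_min_modulus (kap : R) (H : C -> C) :
  smooth kap H -> (forall z, Cmod z <= kap -> H z <> 0%C) ->
  exists m, 0 < m /\ forall z, Cmod z <= kap -> m <= Cmod (H z).
Proof.
  intros [H' [K HK]] H0.
  set (L := Rabs K + 1).
  assert (HL : 0 < L) by (unfold L; pose proof (Rabs_pos K); lra).
  assert (HLip : forall z w, Cmod z <= kap -> Cmod w <= kap ->
    Cmod (H w - H z) <= L * Cmod (w - z)).
  { intros z w Hz Hw; destruct (HK z w Hz Hw) as [_ [H2 _]].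
    apply Rle_trans with (1 := H2), Rmult_le_compat_r; [apply Cmod_ge_0|].
    unfold L; pose proof (Rle_abs K); lra. }
  (* The covering is of the whole square around the disk, so a centre outside the disk gets a
     neighbourhood missing it. Inside, points within [2 d] of [z] change [H] by at most [2 L d],
     which leaves [|H| >= d]. *)
  assert (X : forall z : C, {d : posreal |
    (Cmod z <= kap -> (2 * L + 1) * d <= Cmod (H z)) /\
    (kap < Cmod z -> 2 * d <= Cmod z - kap)}).
  { intro z; destruct (Rle_lt_dec (Cmod z) kap) as [Hz|Hz].
    - assert (Hd : 0 < Cmod (H z) / (2 * L + 1)).
      { apply Rdiv_lt_0_compat; [|lra]; apply Cmod_gt_0; auto. }
      exists (mkposreal _ Hd); split; [|lra].
      intros _; simpl; apply Req_le; field; lra.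
    - assert (Hd : 0 < (Cmod z - kap) / 2) by lra.
      exists (mkposreal _ Hd); split; simpl; lra. }
  destruct (compactness_value_2d (- kap) kap (- kap) kap
    (fun u v => proj1_sig (X (u, v)))) as [d Hd].
  exists d; split; [apply cond_pos|].
  intros [x y] Hz; apply Rnot_lt_le; intro Hlt.
  assert (Hxy : Rabs x <= kap /\ Rabs y <= kap).
  { pose proof (Rmax_Cmod (x, y)) as Hm; simpl in Hm.
    pose proof (Rmax_l (Rabs x) (Rabs y)); pose proof (Rmax_r (Rabs x) (Rabs y)); lra. }
  destruct Hxy as [Hx Hy]; apply Rabs_le_between in Hx; apply Rabs_le_between in Hy.
  apply (Hd x y); [lra | lra |].
  intros [u [v [_ [_ [Hxu [Hyv Hdd]]]]]].
  destruct (X (u, v)) as [e [He1 He2]]; simpl in *.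
  assert (Hw : Cmod ((x, y) - (u, v)) < 2 * e).
  { replace ((x, y) - (u, v))%C with (RtoC (x - u) + Ci * RtoC (y - v))%C.
    - apply Rle_lt_trans with (1 := Cmod_triangle _ _).
      rewrite Cmod_mult, !Cmod_R, Cmod_Ci; lra.
    - unfold Cminus, Cplus, Cmult, Copp, Ci, RtoC; simpl; f_equal; ring. }
  assert (Htri : forall p q : C, Cmod q <= Cmod p + Cmod (p - q)).
  { intros p q; replace q with (p - (p - q))%C at 1 by ring.
    apply Cmod_minus_le; lra. }
  destruct (Rle_lt_dec (Cmod (u, v)) kap) as [Huv|Huv].
  - specialize (He1 Huv).
    pose proof (HLip (u, v) (x, y) Huv Hz) as H2.
    pose proof (Htri (H (x, y)) (H (u, v))) as H3.
    nra.
  - specialize (He2 Huv); specialize (Htri (x, y) (u, v)); lra.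
Qed.

(* [rem a b k] are the coefficients of [(f - (c_0 + ... + c_(k-1) z^(k-1)) g) / z^k],
   the [k]-th remainder of the division of [f] by [g] in increasing powers of [z],
   and [quot a b] those of the formal series [f / g], if [b 0 <> 0]. *)
Fixpoint rem (a b : nat -> C) (k : nat) : nat -> C :=
  match k with
  | O => a
  | S k => fun n => (rem a b k (S n) - rem a b k 0%nat / b 0%nat * b (S n))%C
  end.

Definition quot (a b : nat -> C) (k : nat) : C := (rem a b k 0%nat / b 0%nat)%C.

Lemma geom_rem (a b : nat -> C) (k : nat) : geom a -> geom b -> geom (rem a b k).
Proof.
  intros Ha Hb; induction k as [|k IH]; auto.
  destruct (geom_lin (fun n => rem a b k (S n)) (fun n => b (S n)) 1 (- quot a b k))
    as [K [th [Hth H]]]; [exact (geom_shift _ 1 IH) | exact (geom_shift _ 1 Hb) |].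
  exists K, th; split; auto; intro n.
  specialize (H n); cbn beta in H; cbn [rem]; fold (quot a b k).
  now replace (rem a b k (S n) - quot a b k * b (S n))%C
    with (1 * rem a b k (S n) + - quot a b k * b (S n))%C by ring.
Qed.

Lemma psum_rem (a b : nat -> C) (k : nat) (z : C) :
  geom a -> geom b -> b 0%nat <> 0%C -> Cmod z <= 1 ->
  psum (rem a b k) z = (quot a b k * psum b z + z * psum (rem a b (S k)) z)%C.
Proof.
  intros Ha Hb Hb0 Hz.
  pose proof (geom_rem a b k Ha Hb) as Hr.
  rewrite (psum_ext (rem a b (S k))
    (fun n => 1 * rem a b k (S n) + - quot a b k * b (S n))%C z (geom_rem a b (S k) Ha Hb) Hz)
    by (intro n; unfold quot; cbn [rem]; ring).
  rewrite (psum_lin (fun n => rem a b k (S n)) (fun n => b (S n))); auto;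
    [| exact (geom_shift _ 1 Hr) | exact (geom_shift _ 1 Hb)].
  destruct Hr as [K [th Hr]], Hb as [K' [th' Hb]].
  rewrite (psum_decr _ _ _ _ Hr Hz), (psum_decr _ _ _ _ Hb Hz).
  unfold quot; field; auto.
Qed.

Definition dominated (a b : nat -> C) : Prop :=
  forall z, Cmod z <= 1 -> Cmod (psum a z) <= Cmod (psum b z).

(* The test polynomials [1 - t z^(M+1)] for the contraction [h |-> (f/g) h]
   of the Hardy space on the circle of radius [kap]. *)
Definition contractive (kap : R) (c : nat -> C) : Prop :=
  forall (M : nat) (t : C),
    sum_f_R0 (fun k => Cmod (c k) ^ 2 * (kap ^ 2) ^ k) M
      + Cmod (c (S M) - t * c 0%nat) ^ 2 * (kap ^ 2) ^ S M
    <= 1 + Cmod t ^ 2 * (kap ^ 2) ^ S M.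

Lemma archimedean_le (x B : R) :
  (forall n, (2 <= n)%nat -> INR (S n) * x <= B) -> x <= 0.
Proof.
  intro Hx; apply Rnot_lt_le; intro Hpos.
  destruct (INR_archimed x B Hpos) as [n Hn].
  specialize (Hx (n + 2)%nat ltac:(lia)).
  rewrite S_INR, plus_INR in Hx; simpl in Hx; lra.
Qed.

Lemma contractive_of_no_zero (kap : R) (a b : nat -> C) :
  0 <= kap <= 1 -> geom a -> geom b -> dominated a b ->
  (forall z, Cmod z <= kap -> psum b z <> 0%C) -> contractive kap (quot a b).
Proof.
  intros [Hk0 Hk1] Ha Hb Hab Hnz M t.
  assert (Hb0 : b 0%nat <> 0%C).
  { destruct Hb as [K [th Hb]].
    specialize (Hnz 0%C); rewrite Cmod_0 in Hnz; intro E; apply Hnz; auto.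
    rewrite (psum_decr _ _ _ 0%C Hb), E; [ring | rewrite Cmod_0; lra]. }
  destruct (smooth_min_modulus kap (psum b)) as [m [Hm Hmin]]; auto using smooth_psum.
  set (phi := fun k z => (psum (rem a b k) z * / psum b z)%C).
  assert (Hphi : forall k, smooth kap (phi k)).
  { intro k; apply smooth_mult.
    - apply smooth_psum; auto; now apply geom_rem.
    - apply smooth_inv with m; auto; now apply smooth_psum. }
  assert (Ephi : forall k z, Cmod z <= kap ->
    phi k z = (quot a b k + z * phi (S k) z)%C).
  { intros k z Hz; unfold phi; rewrite (psum_rem a b k); auto; [|lra].
    field; auto. }
  set (N := S M).
  (* The k-th Taylor remainder of [(1 - t z^N) f/g]. Truncated subtraction lets one formula serve
     both [k < N] and [k >= N]. *)
  set (F := fun k z => (phi k z + - t * z ^ (N - k) * phi (k - N)%nat z)%C).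
  set (d := fun k => if Nat.ltb k N then quot a b k
                     else (quot a b k - t * quot a b (k - N))%C).
  destruct (circle_bessel kap N Hk0 F d) as [B HB].
  { intro k; unfold F; apply smooth_plus; auto.
    apply smooth_mult; auto; apply smooth_mult; [apply smooth_const | apply smooth_pow]. }
  { intros k z Hz; unfold F, d; destruct (Nat.ltb_spec k N) as [Hlt|Hge].
    - replace (N - k)%nat with (S (N - S k)) by lia.
      replace (k - N)%nat with 0%nat by lia; replace (S k - N)%nat with 0%nat by lia.
      rewrite (Ephi k z Hz); simpl; ring.
    - replace (N - k)%nat with 0%nat by lia; replace (N - S k)%nat with 0%nat by lia.
      replace (S k - N)%nat with (S (k - N)) by lia.
      rewrite (Ephi k z Hz), (Ephi (k - N)%nat z Hz); simpl; ring. }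
  destruct (circle_sq_decr kap (fun z => 1 + - t * z ^ N)%C (fun z => - t * z ^ M)%C 1%C Hk0)
    as [B' HB'].
  { apply smooth_mult; [apply smooth_const | apply smooth_pow]. }
  { intros z _; unfold N; simpl; ring. }
  (* The main terms grow like [S n] while the errors stay below [B + B'], so the inequality holds
     without error. *)
  apply Rminus_le, (archimedean_le _ (B + B')); intros n Hn.
  specialize (HB n Hn); specialize (HB' n Hn); apply Rabs_le_between in HB'.
  assert (Hle : circle_sq kap n (F 0%nat) <= circle_sq kap n (fun z => 1 + - t * z ^ N)%C).
  { apply sum_Rle; intros j _.
    set (z := (kap * root n ^ j)%C).
    assert (Hz : Cmod z <= kap) by (unfold z; rewrite Cmod_circle; lra).
    unfold F; rewrite Nat.sub_0_r; simpl (0 - N)%nat.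
    replace (phi 0%nat z + - t * z ^ N * phi 0%nat z)%C
      with (phi 0%nat z * (1 + - t * z ^ N))%C by ring.
    apply pow_incr; split; [apply Cmod_ge_0|].
    rewrite Cmod_mult.
    assert (Cmod (phi 0%nat z) <= 1).
    { unfold phi; simpl; rewrite Cmod_mult, Cmod_inv by auto.
      pose proof (Hab z (Rle_trans _ _ _ Hz Hk1)) as Hfg.
      assert (0 < Cmod (psum b z)) by (apply Cmod_gt_0; auto).
      apply Rmult_le_reg_r with (Cmod (psum b z)); auto.
      rewrite Rmult_assoc, Rinv_l by lra; lra. }
    pose proof (Cmod_ge_0 (1 + - t * z ^ N)); nra. }
  assert (Esq : circle_sq kap n (fun z => - t * z ^ M)%C
    = INR (S n) * (Cmod t ^ 2 * (kap ^ 2) ^ M)).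
  { unfold circle_sq.
    rewrite (sum_eq _ (fun _ => Cmod t ^ 2 * (kap ^ 2) ^ M)); [rewrite sum_cte; ring|].
    intros j _; rewrite Cmod_mult, Cmod_opp, Cmod_pow, Cmod_circle by auto.
    rewrite Rpow_mult_distr, <- !pow_mult; do 2 f_equal; lia. }
  rewrite Esq, Cmod_1 in HB'.
  assert (Ed : sum_f_R0 (fun k => Cmod (d k) ^ 2 * (kap ^ 2) ^ k) N
    = sum_f_R0 (fun k => Cmod (quot a b k) ^ 2 * (kap ^ 2) ^ k) M
      + Cmod (quot a b (S M) - t * quot a b 0%nat) ^ 2 * (kap ^ 2) ^ S M).
  { unfold N; rewrite tech5; f_equal.
    - apply sum_eq; intros k Hk; unfold d.
      destruct (Nat.ltb_spec k N); auto; unfold N in *; lia.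
    - unfold d, N; rewrite Nat.ltb_irrefl, Nat.sub_diag; reflexivity. }
  rewrite Ed in HB; unfold N in *; cbn [pow] in *; lra.
Qed.

(** * Division by Blaschke factors *)

Lemma rem_ext (a b a' b' : nat -> C) (k n : nat) :
  (forall n, a n = a' n) -> (forall n, b n = b' n) -> rem a b k n = rem a' b' k n.
Proof.
  intros Ea Eb; revert n; induction k as [|k IH]; intro n; simpl; auto.
  now rewrite !IH, !Eb.
Qed.

Lemma rem_lin_mul (u v : C) (a b : nat -> C) (k n : nat) :
  u <> 0%C -> b 0%nat <> 0%C ->
  rem (lin_mul u v a) (lin_mul u v b) k n = lin_mul u v (rem a b k) n.
Proof.
  intros Hu Hb; revert n; induction k as [|k IH]; intro n; auto.
  cbn [rem]; rewrite !IH; destruct n as [|n]; simpl; field; auto.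
Qed.

(** Every remainder of the division carries the common factor. Used for both [z - al] and
    [1 - Cconj al * z], this shows that division by a Blaschke factor keeps the quotient
    coefficients. *)
Lemma quot_lin_mul (u v : C) (a b : nat -> C) (k : nat) :
  u <> 0%C -> b 0%nat <> 0%C -> quot (lin_mul u v a) (lin_mul u v b) k = quot a b k.
Proof.
  intros Hu Hb; unfold quot; rewrite rem_lin_mul by auto; simpl; field; auto.
Qed.

Lemma lin_mul_of_zero (a : nat -> C) (al : C) (n : nat) :
  geom a -> Cmod al <= 1 -> psum a al = 0%C -> a n = lin_mul (- al) 1 (diff_quot a al) n.
Proof.
  intros Ha Hal H0; rewrite lin_mul_diff_quot by auto.
  destruct n; auto; rewrite H0; ring.
Qed.

(** Both sums are Lipschitz, so the inequality at [al] follows from those at the points [al + e],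
    which lie in the disk for small [e > 0] because [|al| < 1]. *)
Lemma dominated_punctured (a b : nat -> C) (al : C) :
  geom a -> geom b -> Cmod al < 1 ->
  (forall z, Cmod z <= 1 -> z <> al -> Cmod (psum a z) <= Cmod (psum b z)) ->
  dominated a b.
Proof.
  intros Ha Hb Hal Hab z Hz.
  destruct (Ceq_dec z al) as [->|Hne]; [|now apply Hab].
  destruct (smooth_psum 1 a (Rle_refl 1) Ha) as [a' [K HK]].
  destruct (smooth_psum 1 b (Rle_refl 1) Hb) as [b' [L HL]].
  assert (HKL : 0 <= K /\ 0 <= L).
  { destruct (HK al al Hz Hz) as [H1 _], (HL al al Hz Hz) as [H2 _].
    pose proof (Cmod_ge_0 (psum a al)); pose proof (Cmod_ge_0 (psum b al)); lra. }
  apply le_epsilon; intros eps Heps.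
  set (e := Rmin (1 - Cmod al) (eps / (K + L + 1))).
  assert (He : 0 < e).
  { apply Rmin_pos; [lra | apply Rdiv_lt_0_compat; lra]. }
  assert (He1 : e <= 1 - Cmod al) by apply Rmin_l.
  assert (He2 : (K + L + 1) * e <= eps).
  { apply Rle_trans with ((K + L + 1) * (eps / (K + L + 1))).
    - apply Rmult_le_compat_l; [lra | apply Rmin_r].
    - apply Req_le; field; lra. }
  assert (Hd : Cmod (al + e - al) = e).
  { replace (al + e - al)%C with (RtoC e) by ring; rewrite Cmod_R, Rabs_pos_eq; lra. }
  assert (Hae : Cmod (al + e) <= 1).
  { apply Rle_trans with (1 := Cmod_triangle _ _).
    rewrite Cmod_R, Rabs_pos_eq; lra. }
  assert (Hn : (al + e)%C <> al).
  { intro E; rewrite E in Hd; replace (al - al)%C with (RtoC 0) in Hd by ring.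
    rewrite Cmod_0 in Hd; lra. }
  specialize (Hab _ Hae Hn).
  destruct (HK al (al + e)%C Hz Hae) as [_ [H1 _]], (HL al (al + e)%C Hz Hae) as [_ [H2 _]].
  rewrite Hd in H1, H2.
  assert (H3 : Cmod (psum a al) <= Cmod (psum a (al + e)%C) + K * e).
  { replace (psum a al) with (psum a (al + e)%C - (psum a (al + e)%C - psum a al))%C at 1
      by ring.
    apply Cmod_minus_le; auto; lra. }
  assert (H4 : Cmod (psum b (al + e)%C) <= Cmod (psum b al) + L * e).
  { replace (psum b (al + e)%C) with (psum b al + (psum b (al + e)%C - psum b al))%C at 1
      by ring.
    apply Cmod_plus_le; auto; lra. }
  lra.
Qed.

(** Away from [al] one cancels [|z - al|]; the point [al] itself is recovered by continuity. *)
Lemma dominated_diff_quot (a b : nat -> C) (al : C) :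
  geom a -> geom b -> Cmod al < 1 -> dominated a b ->
  psum a al = 0%C -> psum b al = 0%C -> dominated (diff_quot a al) (diff_quot b al).
Proof.
  intros Ha Hb Hal Hab Ea Eb.
  assert (Hal' : Cmod al <= 1) by lra.
  apply dominated_punctured with al; auto using geom_diff_quot.
  intros z Hz Hne; specialize (Hab z Hz).
  pose proof (psum_diff_quot a z al Ha Hz Hal') as Fa.
  pose proof (psum_diff_quot b z al Hb Hz Hal') as Fb.
  rewrite Ea in Fa; rewrite Eb in Fb.
  replace (psum a z) with (psum a z - 0)%C in Hab by ring.
  replace (psum b z) with (psum b z - 0)%C in Hab by ring.
  rewrite Fa, Fb, !Cmod_mult in Hab.
  apply Rmult_le_reg_l with (2 := Hab).
  apply Cmod_gt_0; intro E; apply Hne.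
  replace z with ((z - al) + al)%C by ring; rewrite E; ring.
Qed.

(* On the unit circle [|z - al| = |1 - conj al z|]. *)
Lemma blaschke_energy (h : nat -> C) (al : C) (n : nat) :
  sum_f_R0 (fun k => Cmod (lin_mul 1 (- Cconj al) h k) ^ 2) n
  = sum_f_R0 (fun k => Cmod (lin_mul (- al) 1 h k) ^ 2) n + (1 - Cmod al ^ 2) * Cmod (h n) ^ 2.
Proof.
  induction n as [|n IH].
  - simpl sum_f_R0; unfold lin_mul; rewrite !Cmod_mult, Cmod_opp, Cmod_1; ring.
  - rewrite !tech5, IH; unfold lin_mul; rewrite !Cmod2_alt.
    destruct (h n), (h (S n)), al; simpl; ring.
Qed.

(** Serves to make the boundary term [(1 - |al|^2) |h n|^2] of [blaschke_energy] negligible. *)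
Lemma geom_small (a : nat -> C) (eps : R) (m : nat) :
  geom a -> 0 < eps -> exists n, (m <= n)%nat /\ Cmod (a n) ^ 2 <= eps.
Proof.
  intros [K [th Ha]] Heps; pose proof (geom_bounded_K_pos _ _ _ Ha) as HK.
  destruct Ha as [Hth Ha].
  destruct (pow_lt_1_zero th) with (y := Rmin 1 (eps / (K * K + 1))) as [N HN].
  - rewrite Rabs_pos_eq; lra.
  - apply Rmin_pos; [lra | apply Rdiv_lt_0_compat; nra].
  - exists (N + m)%nat; split; [lia|].
    specialize (HN (N + m)%nat ltac:(lia)); specialize (Ha (N + m)%nat).
    set (q := th ^ (N + m)) in *.
    assert (Hq : 0 <= q) by (apply pow_le; lra).
    rewrite Rabs_pos_eq in HN by auto.
    pose proof (Rmin_l 1 (eps / (K * K + 1))); pose proof (Rmin_r 1 (eps / (K * K + 1))).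
    assert (He : (K * K + 1) * q <= eps).
    { apply Rle_trans with ((K * K + 1) * (eps / (K * K + 1))).
      - apply Rmult_le_compat_l; nra.
      - apply Req_le; field; nra. }
    apply Rle_trans with ((K * q) ^ 2).
    + apply pow_incr; split; [apply Cmod_ge_0 | auto].
    + assert (0 <= K * K) by nra.
      assert (K * K * (q * q) <= K * K * q).
      { apply Rmult_le_compat_l; nra. }
      simpl; nra.
Qed.

Lemma geom_energy_bounded (a : nat -> C) :
  geom a -> exists E, forall n, sum_f_R0 (fun k => Cmod (a k) ^ 2) n <= E.
Proof.
  intros [K [th Ha]]; pose proof (geom_bounded_K_pos _ _ _ Ha) as HK.
  destruct Ha as [Hth Ha].
  exists (K * K / (1 - th)); intro n.
  apply Rle_trans with (sum_f_R0 (fun k => th ^ k * (K * K)) n).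
  - apply sum_Rle; intros k _.
    pose proof (pow_le_1 th k ltac:(lra)).
    apply Rle_trans with ((K * th ^ k) ^ 2).
    + apply pow_incr; split; [apply Cmod_ge_0 | auto].
    + replace ((K * th ^ k) ^ 2) with (K * K * (th ^ k * th ^ k)) by ring.
      rewrite (Rmult_comm (th ^ k) (K * K)); apply Rmult_le_compat_l; nra.
  - rewrite <- scal_sum, tech3 by lra.
    assert (0 <= th ^ S n) by (apply pow_le; lra).
    unfold Rdiv; apply Rmult_le_compat_l; [nra|].
    rewrite <- (Rmult_1_l (/ (1 - th))) at 2.
    apply Rmult_le_compat_r; [|lra].
    apply Rlt_le, Rinv_0_lt_compat; lra.
Qed.

(* Dividing [g] by the Blaschke factor of a zero [al] with [|al| <= kap] preserves
   the energy and multiplies [|g 0|] by at least [1 / kap], so the process stops. *)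
Lemma contractive_of_energy (kap E : R) (n : nat) :
  0 < kap < 1 -> forall a b : nat -> C,
  geom a -> geom b -> dominated a b ->
  (forall m, sum_f_R0 (fun k => Cmod (b k) ^ 2) m <= E) ->
  E * (kap ^ 2) ^ n < Cmod (b 0%nat) ^ 2 ->
  contractive kap (quot a b).
Proof.
  intro Hk; induction n as [|n IH]; intros a b Ha Hb Hab HE Hn.
  (* For [n = 0] the hypothesis says [E < |b 0|^2], against the energy bound. *)
  { specialize (HE 0%nat); simpl in *; lra. }
  destruct (classic (exists al, Cmod al <= kap /\ psum b al = 0%C)) as [[al [Hal Eb]]|Hno].
  2:{ apply contractive_of_no_zero; auto; [lra|].
      intros z Hz Ez; apply Hno; now exists z. }
  assert (Hal1 : Cmod al < 1) by lra; assert (Hal1' : Cmod al <= 1) by lra.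
  assert (Ea : psum a al = 0%C).
  { apply Cmod_eq_0; pose proof (Cmod_ge_0 (psum a al)).
    specialize (Hab al Hal1'); rewrite Eb, Cmod_0 in Hab; lra. }
  assert (Hb0 : Cmod (b 0%nat) <> 0).
  { intro E0; rewrite E0 in Hn.
    assert (0 <= E).
    { apply Rle_trans with (2 := HE 0%nat); apply pow2_ge_0. }
    assert (0 <= E * (kap ^ 2) ^ S n).
    { apply Rmult_le_pos; auto; apply pow_le, pow2_ge_0. }
    simpl in *; lra. }
  set (a1 := diff_quot a al); set (b1 := diff_quot b al).
  assert (Ha1 : geom a1) by (apply geom_diff_quot; auto).
  assert (Hb1 : geom b1) by (apply geom_diff_quot; auto).
  pose proof (fun m => lin_mul_of_zero a al m Ha Hal1' Ea) as Fa; fold a1 in Fa.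
  pose proof (fun m => lin_mul_of_zero b al m Hb Hal1' Eb) as Fb; fold b1 in Fb.
  pose proof (f_equal Cmod (Fb 0%nat)) as Fb0; simpl in Fb0.
  rewrite Cmod_mult, Cmod_opp in Fb0.
  assert (Hal0 : (- al)%C <> 0%C).
  { intro E0; apply (f_equal Cmod) in E0; rewrite Cmod_opp, Cmod_0 in E0.
    rewrite E0, Rmult_0_l in Fb0; auto. }
  assert (Hb10 : b1 0%nat <> 0%C).
  { intro E0; rewrite E0, Cmod_0, Rmult_0_r in Fb0; auto. }
  pose proof (dominated_diff_quot a b al Ha Hb Hal1 Hab Ea Eb) as H1.
  fold a1 in H1; fold b1 in H1.
  assert (Hq : forall k, quot (lin_mul 1 (- Cconj al) a1) (lin_mul 1 (- Cconj al) b1) k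
    = quot a b k).
  { intro k; rewrite quot_lin_mul by (auto; apply C1_nz).
    rewrite <- (quot_lin_mul (- al) 1 a1 b1) by auto.
    unfold quot; rewrite <- Fb; now rewrite (rem_ext a b _ _ k 0 Fa Fb). }
  intros M t; rewrite <- !Hq.
  rewrite (sum_eq _ (fun k => Cmod (quot (lin_mul 1 (- Cconj al) a1)
    (lin_mul 1 (- Cconj al) b1) k) ^ 2 * (kap ^ 2) ^ k)) by (intros; now rewrite Hq).
  apply (IH (lin_mul 1 (- Cconj al) a1) (lin_mul 1 (- Cconj al) b1)).
  - now apply geom_lin_mul.
  - now apply geom_lin_mul.
  - intros z Hz; rewrite !psum_lin_mul, !Cmod_mult by auto.
    apply Rmult_le_compat_l; [apply Cmod_ge_0 | now apply H1].
  (* Partial energies are preserved only up to a boundary term, so the sum is first extended to an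
     index [p] where that term is at most [eps]. *)
  - intro m; apply le_epsilon; intros eps Heps.
    destruct (geom_small b1 eps m Hb1 Heps) as [p [Hp Hs]].
    apply Rle_trans with (sum_f_R0 (fun k => Cmod (lin_mul 1 (- Cconj al) b1 k) ^ 2) p).
    + destruct (Nat.eq_dec m p) as [->|Hmp]; [lra|].
      rewrite (tech2 _ m p) by lia.
      assert (0 <= sum_f_R0 (fun i => Cmod (lin_mul 1 (- Cconj al) b1 (S m + i)) ^ 2)
        (p - S m)) by (apply cond_pos_sum; intro; apply pow2_ge_0).
      lra.
    + rewrite blaschke_energy.
      apply Rplus_le_compat.
      * rewrite (sum_eq _ (fun k => Cmod (b k) ^ 2)); auto.
        intros i _; now rewrite <- Fb.
      * pose proof (pow2_ge_0 (Cmod al)); pose proof (pow2_ge_0 (Cmod (b1 p))).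
        nra.
  (* The new constant coefficient is [b1 0], and [|b 0| = |al| |b1 0| <= kap |b1 0|]; this gains the
     factor [kap^2] that lowers [n] by one. *)
  - cbn [lin_mul]; rewrite Cmult_1_l.
    rewrite Fb0 in Hn.
    assert (Hle : (Cmod al * Cmod (b1 0%nat)) ^ 2 <= kap ^ 2 * Cmod (b1 0%nat) ^ 2).
    { rewrite Rpow_mult_distr; apply Rmult_le_compat_r; [apply pow2_ge_0|].
      apply pow_incr; split; [apply Cmod_ge_0 | auto]. }
    apply Rmult_lt_reg_l with (kap ^ 2); [apply pow_lt; lra|].
    cbn [pow] in *; lra.
Qed.

Lemma contractive_of_dominated (kap : R) (a b : nat -> C) :
  0 < kap < 1 -> geom a -> geom b -> dominated a b -> b 0%nat <> 0%C ->
  contractive kap (quot a b).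
Proof.
  intros Hk Ha Hb Hab Hb0.
  destruct (geom_energy_bounded b Hb) as [E HE].
  assert (Hb0' : 0 < Cmod (b 0%nat) ^ 2) by (apply pow_lt, Cmod_gt_0; auto).
  assert (HE0 : 0 < E).
  { apply Rlt_le_trans with (1 := Hb0'); exact (HE 0%nat). }
  destruct (pow_lt_1_zero (kap ^ 2)) with (y := Cmod (b 0%nat) ^ 2 / E) as [N HN].
  - rewrite Rabs_pos_eq by apply pow2_ge_0; simpl; nra.
  - now apply Rdiv_lt_0_compat.
  - apply (contractive_of_energy kap E N); auto.
    specialize (HN N (Nat.le_refl N)).
    rewrite Rabs_pos_eq in HN by apply pow_le, pow2_ge_0.
    apply (Rmult_lt_compat_l E) in HN; auto.
    replace (E * (Cmod (b 0%nat) ^ 2 / E)) with (Cmod (b 0%nat) ^ 2) in HN by (field; lra).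
    auto.
Qed.

(** * Coefficient estimates *)

(** Undoing a dilation by [rho] shrinks the radius to [kap * rho]; the test parameter becomes
    [t * rho^(M+1)]. *)
Lemma contractive_scale (kap rho : R) (c : nat -> C) :
  0 <= rho -> contractive kap (fun k => (c k * (rho ^ k)%R)%C) -> contractive (kap * rho) c.
Proof.
  intros Hr Hc M t; specialize (Hc M (t * (rho ^ S M)%R)%C); cbn beta in Hc.
  assert (E : forall k, (rho ^ k) ^ 2 * (kap ^ 2) ^ k = ((kap * rho) ^ 2) ^ k).
  { intro k; rewrite Rpow_mult_distr, (Rpow_mult_distr (kap ^ 2)), <- !pow_mult.
    rewrite Rmult_comm; do 2 f_equal; lia. }
  rewrite pow_O, Cmult_1_r in Hc.
  replace (c (S M) * (rho ^ S M)%R - t * (rho ^ S M)%R * c 0%nat)%C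
    with ((c (S M) - t * c 0%nat) * (rho ^ S M)%R)%C in Hc by ring.
  rewrite !Cmod_mult, !Cmod_R, (Rabs_pos_eq (rho ^ S M)) in Hc by (apply pow_le; auto).
  rewrite !Rpow_mult_distr, !Rmult_assoc, !E in Hc.
  rewrite (sum_eq _ (fun k => Cmod (c k) ^ 2 * ((kap * rho) ^ 2) ^ k)) in Hc; auto.
  intros k _; rewrite Cmod_mult, Cmod_R, Rabs_pos_eq by (apply pow_le; auto).
  now rewrite Rpow_mult_distr, Rmult_assoc, E.
Qed.

(** For fixed [M] and [t] the condition is a polynomial inequality in the squared radius, so it
    passes to the limit 1. The radius is a product because [rho] serves both as dilation factor and
    as radius. *)
Lemma contractive_limit (c : nat -> C) :
  (forall rho, 0 < rho < 1 -> contractive (rho * rho) c) -> contractive 1 c.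
Proof.
  intros Hc M t.
  set (G := fun x => sum_f_R0 (fun k => Cmod (c k) ^ 2 * x ^ k) M
    + (Cmod (c (S M) - t * c 0%nat) ^ 2 - Cmod t ^ 2) * x ^ S M).
  assert (HG : forall rho, 0 < rho < 1 -> G (((rho * rho) ^ 2)) <= 1).
  { intros rho Hrho; specialize (Hc rho Hrho M t); unfold G; lra. }
  assert (HG1 : G 1 <= 1).
  { apply le_epsilon; intros eps Heps.
    assert (HGc : continuity G).
    { unfold G; apply continuity_plus; [apply continuity_finite_sum|].
      apply continuity_scal, derivable_continuous, derivable_pow. }
    destruct (HGc 1 eps Heps) as [dl [Hdl Hcont]].
    (* [1 - rho^4 <= 4 (1 - rho) <= dl / 2], within the modulus of continuity [dl]. *)
    set (rho := 1 - Rmin (1 / 2) (dl / 8)).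
    assert (Hrho : 0 < rho < 1 /\ 1 - rho <= dl / 8).
    { unfold rho; pose proof (Rmin_l (1 / 2) (dl / 8)); pose proof (Rmin_r (1 / 2) (dl / 8)).
      pose proof (Rmin_pos (1 / 2) (dl / 8)); lra. }
    destruct Hrho as [Hrho Hd].
    assert (Hq : (rho * rho) ^ 2 < 1 /\ 1 - (rho * rho) ^ 2 < dl).
    { assert (0 < rho * rho < 1) by nra.
      assert (1 - rho * rho <= dl / 4) by nra.
      simpl; split; nra. }
    specialize (Hcont ((rho * rho) ^ 2)).
    assert (Hdist : R_dist (G ((rho * rho) ^ 2)) (G 1) < eps).
    { apply Hcont; split.
      - split; [exact I | lra].
      - simpl; unfold R_dist; apply Rabs_def1; simpl in *; lra. }
    specialize (HG rho Hrho); apply Rabs_def2 in Hdist; lra. }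
  unfold G in HG1; rewrite !(pow1 2); lra.
Qed.

Lemma contractive_1_energy (c : nat -> C) (M : nat) :
  contractive 1 c ->
  Cmod (c 0%nat) ^ 2 + sum_f_R0 (fun k => Cmod (c (S k)) ^ 2) M <= 1.
Proof.
  intro Hc; specialize (Hc M 0%C).
  replace (c (S M) - 0 * c 0%nat)%C with (c (S M)) in Hc by ring.
  rewrite Cmod_0, !pow1 in Hc.
  pose proof (decomp_sum (fun k => Cmod (c k) ^ 2) (S M) ltac:(lia)) as E.
  cbn [pred] in E; rewrite <- E, tech5.
  rewrite (sum_eq _ (fun k => Cmod (c k) ^ 2)) in Hc by (intros; rewrite !pow1; ring).
  simpl in *; lra.
Qed.

Lemma contractive_1_schwarz (c : nat -> C) (M : nat) :
  contractive 1 c -> Cmod (c 0%nat) < 1 ->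
  sum_f_R0 (fun k => Cmod (c k) ^ 2) M + Cmod (c (S M)) ^ 2 / (1 - Cmod (c 0%nat) ^ 2) <= 1.
Proof.
  intros Hc Hx.
  set (x := Cmod (c 0%nat)) in *.
  assert (Hx0 : 0 <= x) by apply Cmod_ge_0.
  assert (Hxx : 0 < 1 - x ^ 2) by (simpl; nra).
  (* This [t] maximizes [|c_N - t c_0|^2 - |t|^2] for [N = S M]; the maximum is
     [|c_N|^2 / (1 - x^2)]. *)
  specialize (Hc M (- (Cconj (c 0%nat) * c (S M) * (/ (1 - x ^ 2))%R))%C).
  rewrite Cmod_opp, !Cmod_mult, Cmod_conj, Cmod_R, !pow1 in Hc; fold x in Hc.
  replace (c (S M) - _)%C with (c (S M) * (/ (1 - x ^ 2))%R)%C in Hc.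
  - rewrite Cmod_mult, Cmod_R, !Rabs_pos_eq in Hc
      by (apply Rlt_le, Rinv_0_lt_compat; lra).
    rewrite (sum_eq _ (fun k => Cmod (c k) ^ 2)) in Hc by (intros; rewrite !pow1; ring).
    set (s := sum_f_R0 _ M) in *; set (y := Cmod (c (S M))) in *.
    replace (y ^ 2 / (1 - x ^ 2))
      with ((y * / (1 - x ^ 2)) ^ 2 * 1 - (x * y * / (1 - x ^ 2)) ^ 2 * 1)
      by (field; simpl in *; lra).
    lra.
  - assert (E : (c 0%nat * Cconj (c 0%nat))%C = RtoC (x ^ 2))
      by (symmetry; apply Cmod2_conj).
    assert (E2 : RtoC (/ (1 - x ^ 2)) = (1 + (x ^ 2)%R * (/ (1 - x ^ 2))%R)%C).
    { rewrite <- RtoC_mult, <- RtoC_plus; f_equal; field; simpl in *; lra. }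
    rewrite E2 at 1; rewrite <- E; ring.
Qed.

(** The differences [e (k+1) - y * e k], preceded by [e 0], have partial sums at most [A], hence so
    does their sum against the decreasing weights [p^k]. That weighted sum is at least [1 - y p]
    times the weighted sum of [e]. *)
Lemma abel_bound (e : nat -> R) (y A p : R) :
  (forall k, 0 <= e k) -> 0 <= p <= 1 -> 0 <= y -> e 0%nat <= A ->
  (forall M, sum_f_R0 e (S M) - y * sum_f_R0 e M <= A) ->
  forall N, sum_f_R0 (fun k => e k * p ^ k) N * (1 - y * p) <= A.
Proof.
  intros He Hp Hy H0 HA.
  assert (Hpos : forall N, 0 <= sum_f_R0 (fun k => e k * p ^ k) N).
  { intro N; apply cond_pos_sum; intro k; apply Rmult_le_pos; auto; apply pow_le; lra. }
  (* The subtracted slack, [p^(N+1)] times the gap between [A] and the partial sum, is what makes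
     the induction close. *)
  assert (Hind : forall N,
    sum_f_R0 (fun k => e k * p ^ k) (S N) - y * p * sum_f_R0 (fun k => e k * p ^ k) N
    <= A - p ^ S N * (A - (sum_f_R0 e (S N) - y * sum_f_R0 e N))).
  { induction N as [|N IH]; [simpl; nra|].
    rewrite (tech5 (fun k => e k * p ^ k) (S N)), (tech5 (fun k => e k * p ^ k) N).
    rewrite (tech5 (fun k => e k * p ^ k) N) in IH.
    specialize (HA N).
    rewrite (tech5 e (S N)), (tech5 e N) in *.
    set (D := A - (sum_f_R0 e N + e (S N) - y * sum_f_R0 e N)) in *.
    assert (0 <= (1 - p) * (p ^ S N * D)).
    { apply Rmult_le_pos; [lra|]; apply Rmult_le_pos; [apply pow_le|]; unfold D; lra. }
    set (U := sum_f_R0 (fun k => e k * p ^ k) N) in *.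
    set (S1 := sum_f_R0 e N) in *.
    unfold D in *; cbn [pow] in *; nra. }
  assert (Hyp : 0 <= y * p) by nra.
  intros [|N].
  - specialize (He 0%nat); simpl; nra.
  - specialize (Hind N); specialize (HA N); specialize (Hpos N) as Hp0.
    assert (0 <= p ^ S N * (A - (sum_f_R0 e (S N) - y * sum_f_R0 e N))).
    { apply Rmult_le_pos; [apply pow_le; lra | lra]. }
    rewrite (tech5 (fun k => e k * p ^ k) N) in *.
    assert (Ht : 0 <= e (S N) * p ^ S N) by (apply Rmult_le_pos; auto; apply pow_le; lra).
    assert (0 <= y * p * (e (S N) * p ^ S N)) by now apply Rmult_le_pos.
    lra.
Qed.

Lemma sum_geom_le (q : R) (N : nat) : 0 <= q < 1 -> sum_f_R0 (pow q) N <= / (1 - q).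
Proof.
  intro Hq; rewrite tech3 by lra.
  assert (0 <= q ^ S N) by (apply pow_le; lra).
  rewrite <- (Rmult_1_l (/ (1 - q))); unfold Rdiv.
  apply Rmult_le_compat_r; [apply Rlt_le, Rinv_0_lt_compat|]; lra.
Qed.

(** Applied term by term with a suitable weight [lam], it replaces Cauchy-Schwarz. *)
Lemma am_gm (lam a b : R) : 0 < lam -> a * b <= (lam * a ^ 2 + b ^ 2 / lam) / 2.
Proof.
  intro Hl.
  assert (0 <= (lam * a - b) ^ 2 / lam).
  { apply Rmult_le_pos; [apply pow2_ge_0 | apply Rlt_le, Rinv_0_lt_compat; auto]. }
  replace ((lam * a - b) ^ 2 / lam) with (lam * a ^ 2 + b ^ 2 / lam - 2 * (a * b)) in H
    by (field; lra).
  lra.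
Qed.

Lemma tail_le_small (c : nat -> C) (r : R) (M : nat) :
  contractive 1 c -> Cmod (c 0%nat) < 1 -> 0 <= r -> r ^ 2 <= (1 - Cmod (c 0%nat)) / 2 ->
  sum_f_R0 (fun k => Cmod (c (S k)) * r ^ S k) M <= 1 - Cmod (c 0%nat).
Proof.
  intros Hc Hx1 Hr Hr2.
  pose proof (contractive_1_energy c M Hc) as HE.
  set (x := Cmod (c 0%nat)) in *.
  assert (Hx0 : 0 <= x) by apply Cmod_ge_0.
  (* The weight [1 / (1 + x)] balances the halves at [(1 - x) / 2] each: the first by the energy
     bound [1 - x^2], the second because [r^2 <= (1 - x) / 2] gives [1 - r^2 >= (1 + x) / 2]. *)
  apply Rle_trans with (sum_f_R0 (fun k => Cmod (c (S k)) ^ 2 * / (2 * (1 + x))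
    + (r ^ 2) ^ k * ((1 + x) * r ^ 2 / 2)) M).
  { apply sum_Rle; intros k _.
    apply Rle_trans with (1 := am_gm (/ (1 + x)) _ _ ltac:(apply Rinv_0_lt_compat; lra)).
    replace ((r ^ S k) ^ 2) with (r ^ 2 * (r ^ 2) ^ k)
      by (rewrite <- !pow_mult, <- pow_add; f_equal; lia).
    apply Req_le; field; lra. }
  rewrite plus_sum, <- !scal_sum.
  assert (Hg := sum_geom_le (r ^ 2) M ltac:(split; [apply pow2_ge_0 | lra])).
  set (s := sum_f_R0 (fun k => Cmod (c (S k)) ^ 2) M) in *.
  assert (H1 : / (2 * (1 + x)) * s <= (1 - x) / 2).
  { apply Rmult_le_reg_l with (2 * (1 + x)); [lra|].
    rewrite <- Rmult_assoc, Rinv_r by lra; simpl in HE; nra. }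
  assert (H2 : (1 + x) * r ^ 2 / 2 * sum_f_R0 (pow (r ^ 2)) M <= (1 - x) / 2).
  { apply Rle_trans with ((1 + x) * r ^ 2 / 2 * / (1 - r ^ 2)).
    - apply Rmult_le_compat_l; auto; pose proof (pow2_ge_0 r); nra.
    - apply Rmult_le_reg_r with (1 - r ^ 2); [lra|].
      rewrite Rmult_assoc, Rinv_l by lra; nra. }
  change (sum_f_R0 (fun i => (r ^ 2) ^ i) M) with (sum_f_R0 (pow (r ^ 2)) M); lra.
Qed.

Lemma tail_le_large (c : nat -> C) (r : R) (M : nat) :
  contractive 1 c -> 1 / 2 <= Cmod (c 0%nat) < 1 -> 0 <= r -> r * (1 + 2 * Cmod (c 0%nat)) <= 1 ->
  sum_f_R0 (fun k => Cmod (c (S k)) * r ^ S k) M <= 1 - Cmod (c 0%nat).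
Proof.
  intros Hc Hx Hr Hr1.
  pose proof (fun n => contractive_1_schwarz c n Hc (proj2 Hx)) as HS.
  set (x := Cmod (c 0%nat)) in *.
  assert (Hy : 0 < 1 - x ^ 2) by (simpl; nra).
  (* Here [p <= 1] since [r <= 1 / (1 + 2x) <= 1/2 <= x]. *)
  set (p := r / x).
  assert (Hpx : p * x = r) by (unfold p; field; lra).
  assert (Hp : 0 <= p <= 1).
  { split; [apply Rdiv_le_0_compat; lra|].
    apply Rmult_le_reg_r with x; [lra|]; nra. }
  set (e := fun k => Cmod (c (S k)) ^ 2).
  assert (HS' : forall n, (1 - x ^ 2) * sum_f_R0 (fun k => Cmod (c k) ^ 2) n + e n <= 1 - x ^ 2).
  { intro n; specialize (HS n).
    apply (Rmult_le_compat_l (1 - x ^ 2)) in HS; [|lra].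
    replace (e n) with ((1 - x ^ 2) * (Cmod (c (S n)) ^ 2 / (1 - x ^ 2)))
      by (unfold e; field; simpl in *; lra).
    lra. }
  assert (HU : sum_f_R0 (fun k => e k * p ^ k) M * (1 - x ^ 2 * p) <= (1 - x ^ 2) ^ 2).
  { apply abel_bound; auto.
    - intro; apply pow2_ge_0.
    - apply pow2_ge_0.
    - specialize (HS' 0%nat); simpl sum_f_R0 in HS'; fold x in HS'.
      simpl in *; nra.
    - intro n; specialize (HS' (S n)).
      rewrite (decomp_sum (fun k => Cmod (c k) ^ 2)) in HS' by lia.
      cbn [pred] in HS'; fold x in HS'; fold e in HS'.
      rewrite tech5; simpl in *; nra. }
  replace (x ^ 2 * p) with (x * r) in HU by (rewrite <- Hpx; ring).
  assert (Hxr : x * r < 1) by nra.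
  (* With the weight [lam * p^(k+1)] in term [k], both halves are bounded by the same [T / 2]. *)
  set (lam := x / (1 - x ^ 2)).
  assert (Hlam : 0 < lam) by (apply Rdiv_lt_0_compat; lra).
  apply Rle_trans with (sum_f_R0 (fun k => e k * p ^ k * (lam * p / 2)
    + (x * r) ^ k * (x * r / lam / 2)) M).
  { apply sum_Rle; intros k _.
    (* For [r = 0] also [p = 0], and the weight of [am_gm] would not be positive. *)
    destruct (Req_dec r 0) as [Hr0|Hr0].
    { rewrite Hr0 at 1; rewrite pow_i, Rmult_0_r by lia.
      assert (0 <= e k) by apply pow2_ge_0.
      assert (0 <= p ^ k) by (apply pow_le; lra).
      assert (0 <= (x * r) ^ k) by (apply pow_le; nra).
      assert (0 <= lam * p / 2) by nra.
      assert (0 <= x * r / lam / 2).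
      { apply Rdiv_le_0_compat; [apply Rdiv_le_0_compat; nra | lra]. }
      apply Rplus_le_le_0_compat; apply Rmult_le_pos; auto; now apply Rmult_le_pos. }
    assert (Hp0 : 0 < p) by (apply Rdiv_lt_0_compat; lra).
    assert (Hl : 0 < lam * p ^ S k) by (apply Rmult_lt_0_compat; auto; now apply pow_lt).
    apply Rle_trans with (1 := am_gm _ _ _ Hl).
    apply Req_le; fold (e k).
    assert (Hpk : p ^ k <> 0) by (apply pow_nonzero; lra).
    rewrite <- Hpx, !Rpow_mult_distr; unfold e; simpl; field; repeat split; auto; lra. }
  rewrite plus_sum, <- !scal_sum.
  pose proof (sum_geom_le (x * r) M ltac:(split; nra)) as Hg.
  (* This is the tail of the majorant series of [(x - z) / (1 - x z)]; [T <= 1 - x] amounts to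
     [r (1 + 2x) <= 1], which is where [r1] comes from. *)
  set (T := (1 - x ^ 2) * r / (1 - x * r)).
  assert (HT : T <= 1 - x).
  { apply Rmult_le_reg_r with (1 - x * r); [lra|].
    replace (T * (1 - x * r)) with ((1 - x ^ 2) * r) by (unfold T; field; lra).
    replace ((1 - x ^ 2) * r) with ((1 - x) * ((1 + x) * r)) by ring.
    apply Rmult_le_compat_l; nra. }
  assert (H1 : lam * p / 2 * sum_f_R0 (fun i => e i * p ^ i) M <= T / 2).
  { set (U := sum_f_R0 _ M) in *.
    assert (HU' : U <= (1 - x ^ 2) ^ 2 / (1 - x * r)).
    { apply Rmult_le_reg_r with (1 - x * r); [lra|].
      replace ((1 - x ^ 2) ^ 2 / (1 - x * r) * (1 - x * r)) with ((1 - x ^ 2) ^ 2)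
        by (field; lra); auto. }
    apply Rle_trans with (lam * p / 2 * ((1 - x ^ 2) ^ 2 / (1 - x * r))).
    - apply Rmult_le_compat_l; auto; nra.
    - apply Req_le; unfold T; rewrite <- Hpx at 2; unfold lam; field.
      split; simpl in *; nra. }
  assert (H2 : x * r / lam / 2 * sum_f_R0 (pow (x * r)) M <= T / 2).
  { apply Rle_trans with (x * r / lam / 2 * / (1 - x * r)).
    - apply Rmult_le_compat_l; auto.
      apply Rdiv_le_0_compat; [apply Rdiv_le_0_compat; nra | lra].
    - apply Req_le; unfold T, lam; field; repeat split; simpl in *; nra. }
  lra.
Qed.

Lemma contractive_1_c0_le (c : nat -> C) : contractive 1 c -> Cmod (c 0%nat) <= 1.
Proof.
  intro Hc; pose proof (contractive_1_energy c 0 Hc) as H; simpl in H.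
  pose proof (Cmod_ge_0 (c 0%nat)); pose proof (Cmod_ge_0 (c 1%nat)); nra.
Qed.

Lemma bohr_sum_le (c : nat -> C) (r : R) (N : nat) :
  contractive 1 c -> 0 <= r <= r1 (Cmod (c 0%nat)) ->
  sum_f_R0 (fun k => Cmod (c k) * r ^ k) N <= 1.
Proof.
  intros Hc [Hr0 Hr].
  pose proof (contractive_1_c0_le c Hc) as Hx1.
  pose proof (Cmod_ge_0 (c 0%nat)) as Hx0.
  destruct N as [|M]; [simpl; lra|].
  rewrite decomp_sum by lia; cbn [pred]; rewrite pow_O, Rmult_1_r.
  enough (sum_f_R0 (fun k => Cmod (c (S k)) * r ^ S k) M <= 1 - Cmod (c 0%nat)) by lra.
  unfold r1 in Hr; destruct (Rlt_dec (Cmod (c 0%nat)) (1 / 2)) as [Hlt|Hge].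
  - apply tail_le_small; auto; [lra|].
    rewrite <- (pow2_sqrt ((1 - Cmod (c 0%nat)) / 2)) by lra.
    apply pow_incr; auto.
  - destruct (Req_dec (Cmod (c 0%nat)) 1) as [E|Hne].
    (* If [|c 0| = 1], the energy bound forces all later coefficients to vanish. *)
    + rewrite E, Rminus_diag.
      rewrite (sum_eq _ (fun _ => 0)); [rewrite sum_cte; lra|].
      intros k _.
      pose proof (contractive_1_energy c k Hc) as H; rewrite E in H.
      assert (Hk : Cmod (c (S k)) ^ 2 <= sum_f_R0 (fun k => Cmod (c (S k)) ^ 2) k).
      { destruct k as [|k]; [simpl; lra|].
        rewrite tech5.
        assert (0 <= sum_f_R0 (fun k => Cmod (c (S k)) ^ 2) k)
          by (apply cond_pos_sum; intro; apply pow2_ge_0).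
        lra. }
      pose proof (Cmod_ge_0 (c (S k))).
      replace (Cmod (c (S k))) with 0; [ring | simpl in *; nra].
    + apply tail_le_large; auto; [lra|].
      apply Rmult_le_reg_r with (/ (1 + 2 * Cmod (c 0%nat))).
      * apply Rinv_0_lt_compat; lra.
      * rewrite Rmult_assoc, Rinv_r by lra; lra.
Qed.

(** The induction peels off one term by [rem_k = c_k g + z rem_(k+1)], hence the generality in [k];
    at [k = 0] the left side is the partial majorant sum of [a]. *)
Lemma rem_majorant_le (a b : nat -> C) (r : R) (N : nat) :
  0 <= r -> b 0%nat <> 0%C -> forall k,
  sum_f_R0 (fun n => Cmod (rem a b k n) * r ^ n) N
  <= sum_f_R0 (fun j => Cmod (quot a b (k + j)) * r ^ j) N
     * sum_f_R0 (fun n => Cmod (b n) * r ^ n) N.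
Proof.
  intros Hr Hb0; induction N as [|N IH]; intro k.
  - simpl; rewrite !Rmult_1_r, Nat.add_0_r, <- Cmod_mult.
    apply Req_le; f_equal; unfold quot; field; auto.
  - pose proof (decomp_sum (fun j => Cmod (quot a b (k + j)) * r ^ j) (S N) ltac:(lia)) as Ec.
    pose proof (decomp_sum (fun n => Cmod (b n) * r ^ n) (S N) ltac:(lia)) as Eb.
    rewrite (decomp_sum (fun n => Cmod (rem a b k n) * r ^ n)) by lia.
    cbn [pred] in *; rewrite Nat.add_0_r in Ec; rewrite pow_O, Rmult_1_r in *.
    set (B1 := sum_f_R0 (fun n => Cmod (b n) * r ^ n) (S N)) in *.
    assert (HB : sum_f_R0 (fun n => Cmod (b n) * r ^ n) N <= B1).
    { unfold B1; rewrite tech5.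
      assert (0 <= Cmod (b (S N)) * r ^ S N)
        by (apply Rmult_le_pos; [apply Cmod_ge_0 | now apply pow_le]).
      lra. }
    assert (H0 : Cmod (rem a b k 0) = Cmod (quot a b k) * Cmod (b 0%nat)).
    { rewrite <- Cmod_mult; f_equal; unfold quot; field; auto. }
    assert (Hs : sum_f_R0 (fun i => Cmod (rem a b k (S i)) * r ^ S i) N
      <= r * sum_f_R0 (fun n => Cmod (rem a b (S k) n) * r ^ n) N
         + Cmod (quot a b k) * sum_f_R0 (fun i => Cmod (b (S i)) * r ^ S i) N).
    { rewrite !scal_sum, <- plus_sum.
      apply sum_Rle; intros i _.
      replace (rem a b k (S i)) with (rem a b (S k) i + quot a b k * b (S i))%C
        by (unfold quot; simpl; ring).
      pose proof (Cmod_triangle (rem a b (S k) i) (quot a b k * b (S i))) as Ht.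
      rewrite Cmod_mult in Ht.
      assert (Hp : 0 <= r ^ S i) by now apply pow_le.
      apply (Rmult_le_compat_r _ _ _ Hp) in Ht.
      cbn [pow] in *; lra. }
    specialize (IH (S k)).
    assert (Hc : sum_f_R0 (fun i => Cmod (quot a b (k + S i)) * r ^ S i) N
      = r * sum_f_R0 (fun j => Cmod (quot a b (S k + j)) * r ^ j) N).
    { rewrite scal_sum; apply sum_eq; intros i _; rewrite Nat.add_succ_r; simpl; ring. }
    rewrite Hc in Ec; rewrite Ec.
    set (T := sum_f_R0 (fun j => Cmod (quot a b (S k + j)) * r ^ j) N) in *.
    assert (HT : 0 <= T).
    { apply cond_pos_sum; intro; apply Rmult_le_pos; [apply Cmod_ge_0 | now apply pow_le]. }
    assert (HTB : r * (T * sum_f_R0 (fun n => Cmod (b n) * r ^ n) N) <= r * (T * B1)).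
    { apply Rmult_le_compat_l; auto; now apply Rmult_le_compat_l. }
    apply (Rmult_le_compat_l r) in IH; auto.
    nra.
Qed.

(** * The majorant inequality *)

Lemma pow_n_Cpow (z : C) (n : nat) : pow_n (K := C_Ring) z n = (z ^ n)%C.
Proof. induction n as [|n IH]; simpl; [|rewrite IH]; reflexivity. Qed.

Lemma is_pseries_C (a : nat -> C) (z l : C) :
  @is_pseries C_AbsRing C_NormedModule a z l <->
  @is_series C_AbsRing C_NormedModule (fun k => Cmult (a k) (Cpow z k)) l.
Proof.
  assert (E : forall n, (pow_n (K := C_Ring) z n * a n = a n * z ^ n)%C)
    by (intro n; rewrite pow_n_Cpow; ring).
  split; intro H; refine (is_series_ext _ _ _ _ H); intro n;
    [exact (E n) | exact (eq_sym (E n))].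
Qed.

Lemma is_series_C_bounded (u : nat -> C) (l : C) :
  @is_series C_AbsRing C_NormedModule u l -> exists K, forall n, Cmod (u n) <= K.
Proof.
  intro Hu.
  destruct (filterlim_bounded (K := C_AbsRing) (V := C_NormedModule) (Csum u)
    (ex_intro _ l Hu)) as [K HK].
  exists (K + K); intros [|n].
  - pose proof (Rle_trans _ _ _ (Cmod_ge_0 _) (HK 0%nat)).
    specialize (HK 0%nat); change (Cmod (Csum u 0) <= K) in HK; rewrite Csum_O in HK.
    lra.
  - replace (u (S n)) with (Csum u (S n) - Csum u n)%C by (rewrite Csum_Sn; ring).
    exact (Cmod_minus_le _ _ _ _ (HK (S n)) (HK n)).
Qed.

Definition dilate (rho : R) (a : nat -> C) (n : nat) : C := (a n * (rho ^ n)%R)%C.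

(** Convergence at a radius [s] between [rho] and 1 bounds [|a n| s^n], which leaves the ratio
    [rho / s < 1]. *)
Lemma geom_dilate (f : C -> C) (a : nat -> C) (rho : R) :
  analytic_in_disk f a -> 0 <= rho < 1 -> geom (dilate rho a).
Proof.
  intros Hf Hr.
  set (s := (1 + rho) / 2).
  assert (Hs : 0 < s < 1 /\ rho < s) by (unfold s; lra).
  destruct Hs as [Hs Hrs].
  specialize (Hf (RtoC s)); rewrite Cmod_R, Rabs_pos_eq in Hf by lra.
  specialize (Hf (proj2 Hs)); apply is_pseries_C in Hf.
  destruct (is_series_C_bounded _ _ Hf) as [K HK].
  exists K, (rho / s); split.
  - split; [apply Rdiv_le_0_compat; lra|].
    apply Rmult_lt_reg_r with s; [lra|].
    unfold Rdiv; rewrite Rmult_assoc, Rinv_l; lra.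
  - intro n; unfold dilate; specialize (HK n).
    rewrite Cmod_mult, Cmod_pow, !Cmod_R, Rabs_pos_eq in HK by lra.
    rewrite Cmod_mult, Cmod_R, Rabs_pos_eq by (apply pow_le; lra).
    replace (Cmod (a n) * rho ^ n) with (Cmod (a n) * s ^ n * (rho / s) ^ n).
    + apply Rmult_le_compat_r; auto; apply pow_le, Rdiv_le_0_compat; lra.
    + rewrite Rmult_assoc, <- Rpow_mult_distr; do 2 f_equal; field; lra.
Qed.

Lemma psum_dilate (f : C -> C) (a : nat -> C) (rho : R) (z : C) :
  analytic_in_disk f a -> 0 <= rho < 1 -> Cmod z <= 1 ->
  psum (dilate rho a) z = f (rho * z)%C.
Proof.
  intros Hf Hr Hz.
  destruct (geom_dilate f a rho Hf Hr) as [K [th H]].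
  apply (psum_unique _ _ _ _ _ H Hz).
  apply (is_series_ext (K := C_AbsRing) (V := C_NormedModule)
    (fun k => Cmult (a k) (Cpow (rho * z) k))).
  - intro n; unfold dilate.
    rewrite RtoC_pow, <- Cmult_assoc; f_equal.
    apply Cpow_mult_l.
  - apply is_pseries_C, Hf.
    rewrite Cmod_mult, Cmod_R, Rabs_pos_eq by lra.
    pose proof (Cmod_ge_0 z); nra.
Qed.

Lemma psum_0 (a : nat -> C) : geom a -> psum a 0%C = a 0%nat.
Proof.
  intros [K [th Ha]]; rewrite (psum_decr _ _ _ _ Ha); [ring | rewrite Cmod_0; lra].
Qed.

(** A zero of [g] at 0 forces one of [f], and the difference quotient at 0 is the shift of
    coefficients; so one factor [z] is removed at a time. *)
Lemma dominated_shift (q : nat) : forall a b : nat -> C,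
  geom a -> geom b -> dominated a b -> (forall k, (k < q)%nat -> b k = 0%C) ->
  (forall k, (k < q)%nat -> a k = 0%C) /\
  dominated (fun n => a (q + n)%nat) (fun n => b (q + n)%nat).
Proof.
  induction q as [|q IH]; intros a b Ha Hb Hab Hb0.
  { split; [intros; lia | exact Hab]. }
  assert (H0 : Cmod 0 <= 1) by (rewrite Cmod_0; lra).
  assert (Eb : psum b 0%C = 0%C) by (rewrite psum_0; auto; apply Hb0; lia).
  assert (Ea : psum a 0%C = 0%C).
  { apply Cmod_eq_0; pose proof (Cmod_ge_0 (psum a 0%C)).
    specialize (Hab 0%C H0); rewrite Eb, Cmod_0 in Hab; lra. }
  pose proof (geom_shift a 1 Ha) as Ha1; pose proof (geom_shift b 1 Hb) as Hb1.
  assert (Hd : forall c n, geom c -> diff_quot c 0 n = c (S n)).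
  { intros c n Hc; unfold diff_quot.
    rewrite (psum_0 _ (geom_shift c (S n) Hc)); now rewrite Nat.add_0_r. }
  destruct (IH (fun n => a (1 + n)%nat) (fun n => b (1 + n)%nat)) as [H1 H2]; auto.
  - intros z Hz.
    rewrite <- (psum_ext (diff_quot a 0) (fun n => a (1 + n)%nat) z),
      <- (psum_ext (diff_quot b 0) (fun n => b (1 + n)%nat) z)
      by first [now apply geom_diff_quot | assumption | intro; now apply Hd].
    apply (dominated_diff_quot a b 0%C); auto; rewrite Cmod_0; lra.
  - intros k Hk; apply Hb0; lia.
  - split; [|exact H2].
    intros [|k] Hk; [now rewrite <- psum_0 | apply (H1 k); lia].
Qed.

(** The constant [s] cancels. It is needed as [rho^q], the factor by which the shift of a dilated
    sequence differs from the dilated shift. *)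
Lemma quot_dilate (rho : R) (s : C) (a b : nat -> C) (k : nat) :
  rho <> 0 -> s <> 0%C -> b 0%nat <> 0%C ->
  quot (fun n => s * dilate rho a n)%C (fun n => s * dilate rho b n)%C k
  = dilate rho (quot a b) k.
Proof.
  intros Hr Hs Hb.
  assert (E : forall n, rem (fun n => s * dilate rho a n)%C (fun n => s * dilate rho b n)%C k n
    = (s * rem a b k n * (rho ^ (k + n))%R)%C).
  { induction k as [|k IH]; intro n; cbn [rem]; [unfold dilate; simpl; ring|].
    rewrite !IH, Nat.add_0_r; unfold dilate; rewrite pow_O.
    replace (k + S n)%nat with (k + 1 + n)%nat by lia.
    replace (S k + n)%nat with (k + 1 + n)%nat by lia.
    rewrite !RtoC_pow, !Cpow_add_r; simpl; rewrite ?Cpow_add_r; simpl.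
    field; auto. }
  unfold quot at 1; rewrite E, Nat.add_0_r; unfold dilate, quot; rewrite pow_O.
  field; auto.
Qed.

Lemma majorant_series_shift (a : nat -> C) (r : R) (q : nat) :
  (forall k, (k < q)%nat -> a k = 0%C) ->
  majorant_series a r = r ^ q * majorant_series (fun n => a (q + n)%nat) r.
Proof.
  revert a; induction q as [|q IH]; intros a Ha.
  - simpl; rewrite Rmult_1_l; reflexivity.
  - unfold majorant_series at 1.
    rewrite Series_incr_1_aux by (rewrite Ha, Cmod_0 by lia; ring).
    rewrite (Series_ext _ (fun k => r * (Cmod (a (1 + k)%nat) * r ^ k)))
      by (intro; simpl; ring).
    rewrite Series_scal_l.
    change (Series (fun k => Cmod (a (1 + k)%nat) * r ^ k))
      with (majorant_series (fun k => a (1 + k)%nat) r).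
    rewrite IH by (intros; apply Ha; lia); simpl; ring.
Qed.

Lemma ex_majorant_series (a : nat -> C) (rho r : R) (q : nat) :
  geom (fun n => dilate rho a (q + n)) -> 0 <= r <= rho -> 0 < rho ->
  ex_series (fun n => Cmod (a (q + n)%nat) * r ^ n).
Proof.
  intros [K [th [Hth Ha]]] Hr Hrho.
  apply (ex_series_le (K := R_AbsRing) (V := R_CompleteNormedModule) _
    (fun n => K / rho ^ q * th ^ n)).
  - intro n; change (norm (Cmod (a (q + n)%nat) * r ^ n))
      with (Rabs (Cmod (a (q + n)%nat) * r ^ n)).
    assert (0 <= r ^ n) by (apply pow_le; lra).
    assert (r ^ n <= rho ^ n) by (apply pow_incr; lra).
    pose proof (Cmod_ge_0 (a (q + n)%nat)) as Hcn.
    rewrite Rabs_pos_eq by (apply Rmult_le_pos; lra).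
    specialize (Ha n); unfold dilate in Ha.
    rewrite Cmod_mult, Cmod_R, Rabs_pos_eq, pow_add in Ha by (apply pow_le; lra).
    assert (Hq : 0 < rho ^ q) by now apply pow_lt.
    apply Rle_trans with (Cmod (a (q + n)%nat) * rho ^ n); [now apply Rmult_le_compat_l|].
    apply Rmult_le_reg_l with (rho ^ q); auto.
    replace (rho ^ q * (K / rho ^ q * th ^ n)) with (K * th ^ n) by (field; lra).
    lra.
  - exists (K / rho ^ q / (1 - th)); now apply is_series_geom_l.
Qed.

Lemma r1_lt_1 (x : R) : 0 <= x -> r1 x < 1.
Proof.
  intro Hx; unfold r1; destruct Rlt_dec as [H|H]; [|apply Rnot_lt_le in H].
  - apply Rlt_le_trans with (sqrt 1); [apply sqrt_lt_1_alt | rewrite sqrt_1]; lra.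
  - apply Rmult_lt_reg_r with (1 + 2 * x); [lra|].
    unfold Rdiv; rewrite Rmult_assoc, Rinv_l; lra.
Qed.

Lemma majorant_series_le (f g : C -> C) (a b : nat -> C) (q : nat) (r : R) :
  analytic_in_disk f a -> analytic_in_disk g b ->
  (forall z, Cmod z < 1 -> Cmod (f z) <= Cmod (g z)) ->
  zero_order_at_0 b q -> 0 <= r <= r1 (Cmod (a q / b q)) ->
  majorant_series a r <= majorant_series b r.
Proof.
  intros Hf Hg Hfg [Hbq Hb0] Hr.
  set (aq := fun n => a (q + n)%nat); set (bq := fun n => b (q + n)%nat).
  assert (Hbq0 : bq 0%nat <> 0%C) by (unfold bq; now rewrite Nat.add_0_r).
  assert (Hrho : forall rho, 0 < rho < 1 ->
    (forall k, (k < q)%nat -> a k = 0%C) /\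
    geom (fun n => dilate rho a (q + n)) /\ geom (fun n => dilate rho b (q + n)) /\
    dominated (fun n => dilate rho a (q + n)) (fun n => dilate rho b (q + n))).
  { intros rho Hrho.
    assert (Hrho' : 0 <= rho < 1) by lra.
    pose proof (geom_dilate f a rho Hf Hrho') as Ga.
    pose proof (geom_dilate g b rho Hg Hrho') as Gb.
    destruct (dominated_shift q (dilate rho a) (dilate rho b)) as [H1 H2]; auto.
    - intros z Hz; rewrite (psum_dilate f), (psum_dilate g) by auto.
      apply Hfg; rewrite Cmod_mult, Cmod_R, Rabs_pos_eq by lra.
      pose proof (Cmod_ge_0 z); nra.
    - intros k Hk; unfold dilate; rewrite Hb0 by auto; ring.
    - split; [|repeat split; auto using geom_shift].
      intros k Hk; specialize (H1 k Hk); unfold dilate in H1.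
      apply (f_equal Cmod) in H1; rewrite Cmod_mult, Cmod_R, Cmod_0 in H1.
      apply Rmult_integral in H1; destruct H1 as [H1|H1]; [now apply Cmod_eq_0|].
      exfalso; revert H1; apply Rabs_no_R0, pow_nonzero; lra. }
  assert (Hc : contractive 1 (quot aq bq)).
  { apply contractive_limit; intros rho Hrho'.
    apply contractive_scale; [lra|].
    destruct (Hrho rho Hrho') as [_ [Ga [Gb Hd]]].
    assert (Hrq : RtoC (rho ^ q) <> 0%C).
    { intro E; apply RtoC_inj in E; revert E; apply pow_nonzero; lra. }
    assert (Hbr : dilate rho b (q + 0) <> 0%C).
    { unfold dilate; rewrite Nat.add_0_r; now apply Cmult_neq_0. }
    pose proof (contractive_of_dominated rho _ _ Hrho' Ga Gb Hd Hbr) as H.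
    assert (E : forall k, quot (fun n => dilate rho a (q + n)) (fun n => dilate rho b (q + n)) k
      = dilate rho (quot aq bq) k).
    { intro k; rewrite <- (quot_dilate rho (rho ^ q)%R) by (auto; lra).
      unfold quot; f_equal; [apply rem_ext|];
        intros; unfold dilate, aq, bq; rewrite pow_add, RtoC_mult; ring. }
    intros M t; specialize (H M t); rewrite !E in H.
    rewrite (sum_eq _ (fun k => Cmod (dilate rho (quot aq bq) k) ^ 2 * (rho ^ 2) ^ k)) in H
      by (intros; now rewrite E).
    exact H. }
  replace (a q / b q)%C with (quot aq bq 0%nat) in Hr
    by (unfold quot, aq, bq; simpl; now rewrite Nat.add_0_r).
  assert (Hr1 : r < 1).
  { pose proof (r1_lt_1 (Cmod (quot aq bq 0%nat)) (Cmod_ge_0 _)); lra. }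
  (* A radius strictly between [r] and 1 makes both majorant series converge at [r], so that
     comparing partial sums compares the values of [Series]. *)
  destruct (Hrho ((1 + r) / 2) ltac:(lra)) as [Ha0 [Ga [Gb _]]].
  rewrite (majorant_series_shift a r q), (majorant_series_shift b r q) by auto.
  apply Rmult_le_compat_l; [apply pow_le; lra|].
  pose proof (ex_majorant_series a _ r q Ga ltac:(lra) ltac:(lra)) as Ea.
  pose proof (ex_majorant_series b _ r q Gb ltac:(lra) ltac:(lra)) as Eb.
  apply Series_correct in Ea; apply Series_correct in Eb.
  refine (is_lim_seq_le _ _ (Finite _) (Finite _) _ Ea Eb).
  intro N; rewrite !sum_n_Reals.
  pose proof (rem_majorant_le aq bq r N (proj1 Hr) Hbq0 0%nat) as Hle.
  pose proof (bohr_sum_le (quot aq bq) r N Hc Hr) as H1.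
  apply Rle_trans with (1 := Hle).
  rewrite <- (Rmult_1_l (sum_f_R0 (fun k => Cmod (b (q + k)%nat) * r ^ k) N)).
  apply Rmult_le_compat_r; auto.
  apply cond_pos_sum; intro; apply Rmult_le_pos; [apply Cmod_ge_0 | apply pow_le; lra].
Qed.

(** * Sharpness *)

Lemma analytic_in_disk_psum (a : nat -> C) : geom a -> analytic_in_disk (psum a) a.
Proof.
  intros [K [th Ha]] z Hz; apply is_pseries_C, (is_series_psum _ K th); auto; lra.
Qed.

(** * The extremal functions: the constant 1 and disk automorphisms *)

Definition delta0 (n : nat) : C := match n with O => 1 | S _ => 0 end.

Lemma geom_delta0 : geom delta0.
Proof.
  apply geom_cons; exists 0, 0; split; [lra|].
  intro n; simpl; rewrite Cmod_0; lra.
Qed.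

Lemma psum_delta0 (z : C) : Cmod z <= 1 -> psum delta0 z = 1%C.
Proof.
  intro Hz; destruct geom_delta0 as [K [th H]].
  rewrite (psum_decr _ _ _ _ H Hz).
  assert (Hb : Cmod (psum (fun n => delta0 (S n)) z) <= 0 / (1 - 0)).
  { apply psum_bound with (th := 0); auto; split; [lra|].
    intro n; simpl; rewrite Cmod_0; lra. }
  replace (psum (fun n => delta0 (S n)) z) with (RtoC 0); [simpl; ring|].
  symmetry; apply Cmod_eq_0; pose proof (Cmod_ge_0 (psum (fun n => delta0 (S n)) z)); lra.
Qed.

Lemma majorant_series_delta0 (r : R) : majorant_series delta0 r = 1.
Proof.
  apply is_series_unique.
  apply (is_series_decr_1 (K := R_AbsRing) (V := R_NormedModule)).
  apply (is_series_ext (K := R_AbsRing) (V := R_NormedModule) (fun n => 0 * 0 ^ n)).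
  - intro n; simpl; rewrite Cmod_0; change (0 * 0 ^ n = 0 * (r * r ^ n)); ring.
  - replace (plus _ _) with (0 / (1 - 0)); [apply is_series_geom_l; lra|].
    simpl; rewrite Cmod_1; change (0 / (1 - 0) = 1 + - (1 * 1)); field.
Qed.

(* Taylor coefficients of [(x - z) / (1 - x z)]. *)
Definition moebius (x : R) (n : nat) : C :=
  match n with O => RtoC x | S m => RtoC (- (1 - x ^ 2) * x ^ m) end.

Lemma geom_moebius (x : R) : 0 <= x < 1 -> geom (moebius x).
Proof.
  intro Hx; apply geom_cons; exists 1, x; split; [lra|].
  intro n; simpl moebius; rewrite Cmod_R, Rabs_mult, Rabs_Ropp.
  assert (0 <= x ^ n) by (apply pow_le; lra).
  assert (0 <= x ^ 2) by apply pow2_ge_0.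
  rewrite !Rabs_pos_eq; simpl in *; nra.
Qed.

Lemma dominated_moebius (x : R) : 0 <= x < 1 -> dominated (moebius x) delta0.
Proof.
  intros Hx z Hz; rewrite psum_delta0, Cmod_1 by auto.
  pose proof (geom_moebius x Hx) as Hg.
  assert (E : ((1 + - x * z) * psum (moebius x) z = x + - (1) * z)%C).
  { rewrite <- psum_lin_mul by auto.
    rewrite (psum_ext _ (lin_mul x (- (1)) delta0)); auto using geom_lin_mul.
    - rewrite psum_lin_mul, psum_delta0 by auto using geom_delta0; ring.
    - intros [|[|n]]; simpl; rewrite ?RtoC_mult, ?RtoC_opp, ?RtoC_minus, ?RtoC_mult; ring. }
  apply (f_equal Cmod) in E; rewrite Cmod_mult in E.
  assert (Hpos : 0 < Cmod (1 + - x * z)).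
  { apply Rlt_le_trans with (1 - x); [lra|].
    assert (H1 : 1 <= Cmod (1 + - x * z) + x).
    { rewrite <- Cmod_1 at 1.
      replace (RtoC 1) with ((1 + - x * z) + x * z)%C at 1 by ring.
      apply Cmod_plus_le; [lra|].
      rewrite Cmod_mult, Cmod_R, Rabs_pos_eq by lra.
      pose proof (Cmod_ge_0 z); nra. }
    lra. }
  assert (Hle : Cmod (x + - (1) * z) <= Cmod (1 + - x * z)).
  { apply Rsqr_incr_0_var; [|apply Cmod_ge_0]; rewrite !Rsqr_pow2.
    assert (Hz2 : Cmod z ^ 2 <= 1).
    { pose proof (Cmod_ge_0 z); simpl; nra. }
    (* This product equals [|1 - x z|^2 - |x - z|^2]. *)
    assert (Hp : 0 <= (1 - x ^ 2) * (1 - Cmod z ^ 2)).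
    { apply Rmult_le_pos; [simpl; nra | lra]. }
    rewrite !Cmod2_alt in *; destruct z as [u v]; simpl in *; lra. }
  apply Rmult_le_reg_l with (1 := Hpos); lra.
Qed.

Lemma majorant_series_moebius (x r : R) :
  0 <= x < 1 -> 0 <= r < 1 ->
  majorant_series (moebius x) r = x + (1 - x ^ 2) * r / (1 - x * r).
Proof.
  intros Hx Hr; apply is_series_unique.
  assert (Hxr : 0 <= x * r < 1) by nra.
  apply (is_series_decr_1 (K := R_AbsRing) (V := R_NormedModule)).
  apply (is_series_ext (K := R_AbsRing) (V := R_NormedModule)
    (fun n => (1 - x ^ 2) * r * (x * r) ^ n)).
  - intro n; simpl moebius; rewrite Cmod_R, Rabs_mult, Rabs_Ropp.
    assert (0 <= x ^ n) by (apply pow_le; lra).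
    rewrite !Rabs_pos_eq; [|auto|simpl; nra].
    rewrite Rpow_mult_distr; simpl; ring.
  - replace (plus _ _) with ((1 - x ^ 2) * r / (1 - x * r)); [now apply is_series_geom_l|].
    simpl moebius; rewrite Cmod_R, Rabs_pos_eq by lra.
    change ((1 - x ^ 2) * r / (1 - x * r)
      = x + (1 - x ^ 2) * r / (1 - x * r) + - (x * r ^ 0)); simpl; ring.
Qed.

Lemma majorant_series_lin_mul (a : nat -> C) (r : R) :
  majorant_series (lin_mul 0 1 a) r = r * majorant_series a r.
Proof.
  rewrite (majorant_series_shift _ r 1).
  - rewrite pow_1; f_equal; apply Series_ext; intro n; simpl; do 2 f_equal; ring.
  - intros k Hk; replace k with 0%nat by lia; simpl; ring.
Qed.

(** Multiplying both functions by [z] raises the order of the zero by one, keeps the leading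
    quotient and multiplies both majorant sums by [r > 0]. *)
Lemma sharpness_z_pow (q : nat) (x r : R) (a b : nat -> C) :
  0 < r -> geom a -> geom b -> dominated a b -> b 0%nat <> 0%C ->
  Cmod (a 0%nat / b 0%nat) = x -> majorant_series b r < majorant_series a r ->
  exists a' b', geom a' /\ geom b' /\ dominated a' b' /\ zero_order_at_0 b' q /\
    Cmod (a' q / b' q) = x /\ majorant_series b' r < majorant_series a' r.
Proof.
  intros Hr Ha Hb Hab Hb0 Hx Hlt; induction q as [|q IH].
  { exists a, b; do 3 (split; [assumption|]); split; [|split; assumption].
    split; [assumption|]; intros k Hk; inversion Hk. }
  destruct IH as [a' [b' [Ga [Gb [Hd [[Hbq Hz] [Hx' Hlt']]]]]]].
  exists (lin_mul 0 1 a'), (lin_mul 0 1 b'); split; [|split; [|split; [|split; [split|split]]]].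
  - now apply geom_lin_mul.
  - now apply geom_lin_mul.
  - intros z H; rewrite !psum_lin_mul, !Cmod_mult by auto.
    apply Rmult_le_compat_l; [apply Cmod_ge_0 | now apply Hd].
  - simpl; rewrite Cmult_0_l, Cplus_0_l, Cmult_1_l; exact Hbq.
  - intros [|k] Hk; simpl; [ring|].
    rewrite (Hz k) by lia; ring.
  - simpl; now rewrite !Cmult_0_l, !Cplus_0_l, !Cmult_1_l.
  - rewrite !majorant_series_lin_mul; now apply Rmult_lt_compat_l.
Qed.

Lemma r1_sharp (q : nat) (x r : R) :
  (1 / 2 <= x < 1 \/ x = 0) -> r1 x < r < 1 ->
  exists a b, geom a /\ geom b /\ dominated a b /\ zero_order_at_0 b q /\
    Cmod (a q / b q) = x /\ majorant_series b r < majorant_series a r.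
Proof.
  intros Hx Hr.
  assert (H10 : RtoC 1 <> 0%C) by apply C1_nz.
  unfold r1 in Hr; destruct (Rlt_dec x (1 / 2)) as [Hlt|Hge].
  - destruct Hx as [Hx|Hx]; [lra|]; subst x.
    replace ((1 - 0) / 2) with (1 / 2) in Hr by field.
    set (s := sqrt (1 / 2)) in *.
    assert (Hs : 0 < s) by (apply sqrt_lt_R0; lra).
    assert (Hss : s * s = 1 / 2) by (apply sqrt_sqrt; lra).
    assert (Hs1 : 0 <= s < 1) by nra.
    apply (sharpness_z_pow q 0 r (lin_mul 0 1 (moebius s)) delta0); try lra.
    + now apply geom_lin_mul, geom_moebius.
    + apply geom_delta0.
    + intros z Hz; rewrite psum_lin_mul, Cmod_mult by auto using geom_moebius.
      pose proof (dominated_moebius s Hs1 z Hz) as Hd.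
      rewrite psum_delta0, Cmod_1 in * by auto.
      replace (0 + 1 * z)%C with z by ring.
      pose proof (Cmod_ge_0 z); pose proof (Cmod_ge_0 (psum (moebius s) z)); nra.
    + exact H10.
    + simpl; replace (0 * s / 1)%C with (RtoC 0) by (field; auto); apply Cmod_0.
    + rewrite majorant_series_lin_mul, majorant_series_delta0, majorant_series_moebius by lra.
      (* Since [r > s], the first summand [s r] exceeds 1/2, and so does the second because
         [r^2 > 1/2 > 1 - s r]. *)
      assert (Hsr : 1 / 2 < s * r < 1) by nra.
      replace (r * (s + (1 - s ^ 2) * r / (1 - s * r)))
        with (s * r + (1 - s * s) * (r * r) / (1 - s * r)) by (field; lra).
      rewrite Hss.
      enough (1 / 2 < (1 - 1 / 2) * (r * r) / (1 - s * r)) by lra.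
      apply Rmult_lt_reg_r with (1 - s * r); [lra|].
      unfold Rdiv at 2; rewrite (Rmult_assoc _ (/ (1 - s * r))), Rinv_l by lra; nra.
  - destruct Hx as [Hx|Hx]; [|lra].
    assert (Hr0 : 0 < r).
    { apply Rlt_trans with (2 := proj1 Hr); apply Rdiv_lt_0_compat; lra. }
    assert (Hrx : 1 < r * (1 + 2 * x)).
    { destruct Hr as [Hr _]; apply (Rmult_lt_compat_r (1 + 2 * x)) in Hr; [|lra].
      replace (1 / (1 + 2 * x) * (1 + 2 * x)) with 1 in Hr by (field; lra); auto. }
    apply (sharpness_z_pow q x r (moebius x) delta0); auto.
    + apply geom_moebius; lra.
    + apply geom_delta0.
    + apply dominated_moebius; lra.
    + simpl; replace (x / 1)%C with (RtoC x) by (field; auto).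
      rewrite Cmod_R, Rabs_pos_eq; lra.
    + rewrite majorant_series_delta0, majorant_series_moebius by lra.
      assert (Hxr : x * r < 1) by nra.
      (* After cancelling [1 - x] this is [1 - x r < (1 + x) r], that is [r > 1 / (1 + 2x)]. *)
      enough (1 - x < (1 - x ^ 2) * r / (1 - x * r)) by lra.
      apply Rmult_lt_reg_r with (1 - x * r); [lra|].
      replace ((1 - x ^ 2) * r / (1 - x * r) * (1 - x * r)) with ((1 - x) * ((1 + x) * r))
        by (field; lra).
      apply Rmult_lt_compat_l; lra.
Qed.

Theorem corollary3 :
  (forall (f g : C -> C) (a b : nat -> C) (q : nat),
     analytic_in_disk f a ->
     analytic_in_disk g b ->
     (forall z : C, Cmod z < 1 -> Cmod (f z) <= Cmod (g z)) ->
     (exists k : nat, b k <> RtoC 0) ->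
     zero_order_at_0 b q ->
     forall r : R, 0 <= r <= r1 (Cmod (a q / b q)%C) ->
       majorant_series a r <= majorant_series b r)
  /\
  (forall (q : nat) (x r : R),
     (1 / 2 <= x < 1 \/ x = 0) ->
     r1 x < r < 1 ->
     exists (f g : C -> C) (a b : nat -> C),
       analytic_in_disk f a /\
       analytic_in_disk g b /\
       (forall z : C, Cmod z < 1 -> Cmod (f z) <= Cmod (g z)) /\
       zero_order_at_0 b q /\
       Cmod (a q / b q)%C = x /\
       ~ (majorant_series a r <= majorant_series b r)).
Proof.
  split.
  - intros f g a b q Hf Hg Hfg _ Hq r Hr.
    exact (majorant_series_le f g a b q r Hf Hg Hfg Hq Hr).
  - intros q x r Hx Hr.
    destruct (r1_sharp q x r Hx Hr) as [a [b [Ga [Gb [Hd [Hq [Hab Hlt]]]]]]].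
    exists (psum a), (psum b), a, b.
    repeat split; auto using analytic_in_disk_psum; try apply Hq.
    + intros z Hz; apply Hd; lra.
    + now apply Rlt_not_le.
Qed.
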